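(* For every integer $r\geq 2$ there exists a constant $\Delta_0$ such that for each graph $G$ with maximum degree $\Delta\geq \Delta_0$ and minimum degree $\delta\geq \ln^8\Delta$, $$s_r(G) < 4\Delta^{r-1}\left(1+ \frac{1}{\ln\Delta}\right) + 12.$$ Hence, for every fixed integer $r\ge 2$, $s_r(G)\leq (4+o(1))\Delta^{r-1}$ for all graphs $G$ with maximum degree $\Delta$, minimum degree $\delta\geq \ln^8\Delta$ and without isolated edges, where $o(1)$ denotes a quantity depending only on $r$ and $\Delta$ that tends to $0$ as $\Delta\to\infty$.
   Context: Graphs are finite and simple. An isolated edge is a connected component isomorphic to $K_2$. For a graph $G=(V,E)$ and a (not necessarily proper) edge colouring $c:E\to\{1,2,\ldots,k\}$, the weighted degree of a vertex $v$ is $w_c(v)=\sum_{u\in N(v)}c(uv)$. For an integer $r\geq 1$, two vertices $u,v$ are $r$-neighbours if $1\leq d(u,v)\leq r$, where $d(u,v)$ is the distance in $G$. The $r$-distant irregularity strength $s_r(G)$ is the least positive integer $k$ for which there is a colouring $c:E\to\{1,2,\ldots,k\}$ with $w_c(u)\neq w_c(v)$ for every pair of $r$-neighbours $u,v$ in $G$; it is well defined if and only if $G$ has no isolated edges. Here $\ln^8\Delta=(\ln\Delta)^8$. *)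

(* Defs.v *)
From HB Require Import structures.
From mathcomp Require Import all_boot all_order all_algebra.
From mathcomp Require Import all_classical all_reals all_analysis.

Set Implicit Arguments.
Unset Strict Implicit.
Unset Printing Implicit Defensive.

Local Open Scope nat_scope.

Record sgraph := SGraph {
  vertex :> finType;
  adj : rel vertex;
  adj_sym : symmetric adj;
  adj_irr : irreflexive adj }.

Arguments adj {s}.

Definition degree (G : sgraph) (v : G) : nat := #|[set u | adj v u]|.

Definition max_degree (G : sgraph) : nat := \max_(v : G) degree v.

(* Every degree is smaller than #|G|, so the unit #|G| of the iterated minimum
   is the value only for the graph without vertices. *)
Definition min_degree (G : sgraph) : nat := \big[minn/#|G|]_(v : G) degree v.

Definition no_isolated_edge (G : sgraph) : Prop :=
  forall u v : G, adj u v -> [set w | connect adj u w] <> [set u; v].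

(* [None] when no natural number satisfies P. *)
Definition least (P : nat -> Prop) : option nat :=
  match pselect (exists n, `[< P n >]) with
  | left exP => Some (ex_minn exP)
  | right _ => None
  end.

(* [None] stands for the infinite distance between different components. *)
Definition dist (G : sgraph) (u v : G) : option nat :=
  least (fun n => exists p : seq G,
    [/\ path adj u p, last u p = v & size p = n]).

Definition r_neighbours (G : sgraph) (r : nat) (u v : G) : Prop :=
  exists2 d, dist u v = Some d & 1 <= d <= r.

(* The edge uv is the set [set u; v]; a colouring is a function on all sets of
   vertices, of which only the values at edges are constrained or used. *)
Definition edge_colouring (G : sgraph) (k : nat) (c : {set G} -> nat) : Prop :=
  forall u v : G, adj u v -> 1 <= c [set u; v] <= k.

Definition wdegree (G : sgraph) (c : {set G} -> nat) (v : G) : nat :=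
  \sum_(u : G | adj v u) c [set u; v].

(* [None] when the strength is not defined. *)
Definition irregularity_strength (r : nat) (G : sgraph) : option nat :=
  least (fun k => 0 < k /\ exists2 c : {set G} -> nat,
    edge_colouring k c &
    forall u v : G, r_neighbours r u v -> wdegree c u <> wdegree c v).

(* Main.v *)
(** Write D = Delta^(r-1) and l = log2 Delta. By the local lemma the vertices can
be split into m = l^3 classes such that every vertex of degree d has about d / m
neighbours in each class. The vertices are then treated class by class, all
edges starting with colour K + 1, where K is slightly more than 2 D. A treated
vertex v is committed to a pair {x, x + t} of weights, disjoint from the pairs
of all treated vertices at distance at most r; from then on an edge from v to a
later vertex may still be changed by t, in the one direction that keeps the
weight of v in its pair. When v is treated, the edges to untreated vertices may
be raised by at most F, about D / l. So the attainable weights form an interval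
with about F d+ + K d- elements, where d+ and d- count later and earlier
neighbours, while the pairs to avoid exclude about 2 D d- of them.

The vertices of the last class have no free forward edges. They are served by
the few first classes, whose vertices use powers of 2 up to about K as steps t in
place of K: these steps fill the gaps between the multiples of K. All colours
stay between 1 and 2 K + F + 1, which is about 4 D.

For bounded Delta any bound depending on Delta and r suffices: colour the edges
by powers of 2 that differ whenever the edges are close. *)

Require Import Defs.
From HB Require Import structures.
From mathcomp Require Import all_boot all_order all_algebra.
From mathcomp Require Import boolp.
From mathcomp Require Import zify ring lra.
Import Order.TTheory GRing.Theory Num.Theory.

Set Implicit Arguments.
Unset Strict Implicit.
Unset Printing Implicit Defensive.
Local Open Scope ring_scope.
Local Open Scope nat_scope.

Lemma card_bigcup_le (I T : finType) (P : pred I) (B : I -> {set T}) (C : {set T}) :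
  #|\bigcup_(i | P i) B i :&: C| <= \sum_(i | P i) #|B i :&: C|.
Proof.
elim/big_rec2: _ => [|i n X _ IH]; first by rewrite set0I cards0.
by rewrite setIUl (leq_trans (leq_card_setU _ _)) // leq_add2l.
Qed.

(** * Walks and balls *)

Definition nbh (G : sgraph) (v : G) : {set G} := [set u | adj v u].

Fixpoint walk_ends (G : sgraph) (v : G) (j : nat) : {set G} :=
  if j is i.+1 then \bigcup_(z in walk_ends v i) nbh z else [set v].

(** Walks are easier to count than shortest paths: apart from [v] itself, the ends of walks of
    lengths 1 to [r] are exactly the [r]-neighbours of [v]. *)
Definition ball (G : sgraph) (r : nat) (v : G) : {set G} :=
  (\bigcup_(j < r) walk_ends v j.+1) :\ v.

Section Walks.
Variable G : sgraph.
Implicit Types (u v w z : G) (P Q : {set G}).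

Lemma in_nbh v u : (u \in nbh v) = adj v u.
Proof. by rewrite inE. Qed.

Lemma card_nbh_max v : #|nbh v| <= max_degree G.
Proof. exact: (leq_bigmax (F := fun v : G => degree v)). Qed.

Lemma min_degree_le v : min_degree G <= #|nbh v|.
Proof.
rewrite /min_degree -[X in _ <= X]/(degree v).
elim: index_enum (mem_index_enum v) => // x s IH; rewrite inE big_cons.
by case/predU1P => [<-|/IH]; [exact: geq_minl | exact/leq_trans/geq_minr].
Qed.

Lemma walk_ends_path v j u :
  reflect (exists p, [/\ path adj v p, last v p = u & size p = j])
          (u \in walk_ends v j).
Proof.
elim: j u => [|j IH] u /=.
  rewrite inE; apply: (iffP eqP) => [->|[p [_ <-]]]; first by exists [::].
  by move/size0nil->.
apply: (iffP bigcupP) => [[z /IH[p [pp lp sp]]]|[p []]].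
  rewrite in_nbh => zu; exists (rcons p u).
  by rewrite rcons_path last_rcons size_rcons pp lp zu sp.
case/lastP: p => // p w; rewrite rcons_path last_rcons size_rcons => /andP[pp].
move=> pw <- [sp]; exists (last v p); last by rewrite in_nbh.
by apply/IH; exists p.
Qed.

Lemma walk_ends_sym v u j : (u \in walk_ends v j) = (v \in walk_ends u j).
Proof.
suff H w z : z \in walk_ends w j -> w \in walk_ends z j by apply/idP/idP; exact: H.
case/walk_ends_path => p [pp <- <-]; apply/walk_ends_path.
exists (rev (belast w p)); split; last by rewrite size_rev size_belast.
  rewrite rev_path; under eq_path => a b do rewrite adj_sym; exact: pp.
by case: p {pp} => //= a p; rewrite rev_cons last_rcons.
Qed.

Lemma ball_sym r v u : (u \in ball r v) = (v \in ball r u).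
Proof.
rewrite !inE eq_sym; congr (_ && _).
by apply/bigcupP/bigcupP => -[j _ Hj]; exists j; rewrite // walk_ends_sym.
Qed.

Lemma walk_ends_ball r v u j :
  0 < j <= r -> u != v -> u \in walk_ends v j -> u \in ball r v.
Proof.
case: j => // j /= jr uv Hu; rewrite in_setD1 uv /=.
by apply/bigcupP; exists (Ordinal jr).
Qed.

Lemma least_min (P : nat -> Prop) n : least P = Some n ->
  P n /\ forall k, P k -> n <= k.
Proof.
rewrite /least; case: pselect => // exP [<-].
case: ex_minnP => m /asboolP Pm minm; split=> // k Pk.
by apply: minm; apply/asboolP.
Qed.

Lemma least_le (P : nat -> Prop) n : P n -> exists2 s, least P = Some s & s <= n.
Proof.
move=> Pn; rewrite /least; case: pselect => [exP|[]]; last first.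
  by exists n; apply/asboolP.
exists (ex_minn exP) => //; case: ex_minnP => m _; apply; exact/asboolP.
Qed.

Lemma r_neighbours_ball r u v : r_neighbours r u v -> v \in ball r u.
Proof.
case=> d /least_min[[p [pp lp sp]] mind] /andP[d0 dr].
apply: (@walk_ends_ball _ _ _ d); first by rewrite d0.
  apply: contraTneq d0 => vu; rewrite -leqNgt; apply: mind.
  by exists [::]; rewrite vu.
by apply/walk_ends_path; exists p.
Qed.

Lemma card_walk_ends v j :
  #|walk_ends v j.+1| <= #|nbh v| * max_degree G ^ j.
Proof.
elim: j => [|j IH]; first by rewrite /= big_set1 muln1.
rewrite -[walk_ends v j.+2]/(\bigcup_(z in walk_ends v j.+1) nbh z).
rewrite -[\bigcup_(z in _) _]setIT (leq_trans (card_bigcup_le _ _ _)) //.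
apply: leq_trans (_ : \sum_(z in walk_ends v j.+1) max_degree G <= _).
  by apply: leq_sum => z _; rewrite setIT card_nbh_max.
by rewrite sum_nat_const expnSr mulnA leq_mul2r IH orbT.
Qed.

Lemma card_ball_le r v Q x b : (forall z, x * #|nbh z :&: Q| <= b) ->
  x * #|ball r.+1 v :&: Q| <=
    x * #|nbh v| + #|nbh v| * (\sum_(j < r) max_degree G ^ j) * b.
Proof.
move=> Hb; apply: leq_trans (_ : \sum_(j < r.+1) x * #|walk_ends v j.+1 :&: Q| <= _).
  rewrite -big_distrr leq_mul2l; apply/orP; right.
  apply: leq_trans (subset_leq_card _) (card_bigcup_le _ _ _).
  by rewrite setSI // subD1set.
rewrite big_ord_recl leq_add //=.
  by rewrite big_set1 leq_mul2l subset_leq_card ?orbT // subsetIl.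
rewrite big_distrr big_distrl leq_sum //= => j _.
rewrite add0n -[\bigcup_(z in walk_ends v j) _]/(walk_ends v j.+1).
apply: leq_trans (_ : x * \sum_(z in walk_ends v j.+1) #|nbh z :&: Q| <= _).
  by rewrite leq_mul2l card_bigcup_le orbT.
rewrite big_distrr (leq_trans (leq_sum _ (fun z _ => Hb z))) //=.
by rewrite sum_nat_const leq_mul2r card_walk_ends orbT.
Qed.

End Walks.

(** * Sums of optional steps *)

(* Partitions the integers into pairs of the form {x, x + t}; for [t = 0] every
   integer is its own mate. *)
Definition mate (t : nat) (x : int) : int :=
  (if t == 0 then x else if odd (absz (x %/ t)%Z) then x - t%:Z else x + t%:Z)%R.

(** A move by [t] changes the quotient by one, hence flips the parity that decides the direction. *)
Lemma mateK t : involutive (mate t).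
Proof.
rewrite /mate => x; case: (eqVneq t 0) => [//|t0].
have tn0 : (Posz t != 0)%R by lia.
have Dsub : ((x - t%:Z) %/ t)%Z = ((x %/ t)%Z - 1)%R.
  by rewrite -[(- t%:Z)%R]mulN1r divzDr ?dvdz_mull // mulzK.
have Dadd : ((x + t%:Z) %/ t)%Z = ((x %/ t)%Z + 1)%R.
  by rewrite -{1}[t%:Z]mul1r divzDr ?dvdz_mull // mulzK.
case xodd: (odd (absz (x %/ t)%Z)).
  have -> : odd (absz ((x - t%:Z) %/ t)%Z) = false by rewrite Dsub; move: xodd; lia.
  lia.
have -> : odd (absz ((x + t%:Z) %/ t)%Z) = true by rewrite Dadd; move: xodd; lia.
lia.
Qed.

Lemma mate_sub t x : (`|mate t x - x| = t%:Z)%R.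
Proof.
rewrite /mate; case: eqP => [->|_]; first by rewrite subrr normr0.
case: ifP => _; lia.
Qed.

Lemma mate0 x : mate 0 x = x. Proof. by []. Qed.

Definition mate_pair (t : nat) (x : int) : seq int := [:: x; mate t x].

Lemma mem_mate_pair t x y : x \in mate_pair t y -> mate_pair t x =i mate_pair t y.
Proof.
rewrite !inE => /orP[/eqP->//|/eqP-> z]; by rewrite !inE mateK orbC.
Qed.

Section Reach.
Variables (T : eqType) (ok : T -> int -> Prop).

Definition reach (s : seq T) (b : int) (N : nat) : Prop :=
  forall y, y <= N -> exists g : T -> int,
    (forall u, u \in s -> ok u (g u)) /\ (\sum_(u <- s) g u = b + y%:Z)%R.

Lemma reach_nil : reach [::] 0 0.
Proof. by move=> [|y] // _; exists (fun=> 0%R); rewrite big_nil. Qed.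

(** One choice at [u] attains a translate of the old interval, the other the same translate moved by
    [d]; as [e <= N.+1], their union has no gap. The sign of [d] decides which one is on the
    left. *)
Lemma reach_cons u s b N (a d : int) (e : nat) :
    u \notin s -> e <= N.+1 -> `|d|%N = e -> reach s b N ->
    ok u a -> ok u (a + d)%R ->
  exists b', reach (u :: s) b' (N + e).
Proof.
move=> us eN de Hs ok1 ok2.
have ext (x : int) (y : nat) : y <= N -> ok u x -> exists g : T -> int,
    (forall w, w \in u :: s -> ok w (g w)) /\
    (\sum_(w <- u :: s) g w = x + (b + y%:Z))%R.
  move=> yN okx; have [g [okg sg]] := Hs y yN.
  exists (fun w => if w == u then x else g w); split=> [w|].
    by rewrite inE; case: eqP => [->|_ /=] //; exact: okg.
  rewrite big_cons eqxx; congr (_ + _)%R; rewrite -sg.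
  apply: eq_big_seq => w ws; case: eqP => // wu.
  by rewrite -wu ws in us.
have [d0|d0] := boolP (0 <= d)%R.
  exists (a + b)%R => y yNe; have [yN|Ny] := leqP y N.
    by have [g [? E]] := ext a y yN ok1; exists g; split=> //; rewrite E addrA.
  have [|g [? E]] := ext (a + d)%R (y - e) _ ok2; first lia.
  by exists g; split=> //; rewrite E; lia.
exists (a + d + b)%R => y yNe; have [yN|Ny] := leqP y N.
  by have [g [? E]] := ext _ y yN ok2; exists g; split=> //; rewrite E addrA.
have [|g [? E]] := ext a (y - e) _ ok1; first lia.
by exists g; split=> //; rewrite E; lia.
Qed.

(* The attainable sums stay an interval as long as no step exceeds the number
   of values attained so far. *)
Lemma reach_cat (e : nat) (s s' : seq T) b N :
    uniq (s ++ s') -> e <= N.+1 -> reach s' b N ->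
    (forall u, u \in s -> exists a d, [/\ ok u a, ok u (a + d)%R & `|d|%N = e]) ->
  exists b', reach (s ++ s') b' (N + e * size s).
Proof.
move=> us eN H; elim: s us => [_ _|u s IH]; first by exists b; rewrite muln0 addn0.
rewrite cat_cons => /=/andP[nu us] Hs.
have [|b1 H1] := IH us; first by move=> w ws; apply: Hs; rewrite inE ws orbT.
have [a [d [o1 o2 de]]] := Hs u (mem_head _ _).
have [|b2 H2] := reach_cons nu _ de H1 o1 o2; first lia.
by exists b2; rewrite mulnS [e + _]addnC addnA.
Qed.

(** The target is distributed greedily: the first entry takes [minn y F], and the truncated
    difference [y - F] is left to the others. *)
Lemma reach_interval (F : nat) (s : seq T) :
    uniq s -> (forall u x, u \in s -> (0 <= x <= F%:Z)%R -> ok u x) ->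
  reach s 0 (F * size s).
Proof.
elim: s => [_ _|u s IH]; first by rewrite muln0; exact: reach_nil.
move=> /=/andP[nu us] Hs y yF.
have [||g [okg sg]] := IH us _ (y - F); last 1 first.
- exists (fun w => if w == u then (minn y F)%:Z else g w); split=> [w|].
    rewrite inE; case: eqP => [->|_ /=] //; last exact: okg.
    by move=> _; apply: Hs; rewrite ?mem_head //; lia.
  rewrite big_cons eqxx; under eq_big_seq => w ws.
    have -> : w == u = false by apply: contraNF nu => /eqP<-.
    over.
  by rewrite /= sg; lia.
- by move=> w x ws; apply: Hs; rewrite inE ws orbT.
- lia.
Qed.

(** Each new step equals the number of values attained so far and doubles it. The list is reversed
    because [reach_cons] puts the newest, largest step at the head. *)
Lemma reach_binary (n : nat) (h : nat -> T) :
    {in [pred j | j < n] &, injective h} ->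
    (forall j, j < n -> exists a d, [/\ ok (h j) a, ok (h j) (a + d)%R & `|d|%N = 2 ^ j]) ->
  exists b, reach (rev [seq h j | j <- iota 0 n]) b (2 ^ n).-1.
Proof.
elim: n => [_ _|n IH inj_h Hh]; first by exists 0%R; exact: reach_nil.
have [|j jn|b Hb] := IH.
- by move=> i j; rewrite !inE => /ltnW Hi /ltnW Hj; apply: inj_h; rewrite inE.
- by apply: Hh; exact: ltnW.
have [a [d [o1 o2 de]]] := Hh n (ltnSn n).
rewrite -[n.+1]addn1 iotaD map_cat rev_cat /= add0n.
have pn := expn_gt0 2 n.
have [||b' Hb'] := reach_cons _ _ de Hb o1 o2.
- rewrite mem_rev; apply/negP => /mapP[j]; rewrite mem_iota add0n => /= jn E.
  by have := inj_h n j; rewrite !inE ltnSn (leqW jn) => /(_ isT isT E) nj; lia.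
- lia.
exists b'; rewrite expnD expn1 /= in Hb' *.
by have -> : (2 ^ n * 2).-1 = (2 ^ n).-1 + 2 ^ n by lia.
Qed.

End Reach.

(** * Greedy colouring *)

Section Greedy.
Variables (G : sgraph) (r : nat) (tau : G -> nat) (K F : nat).
Implicit Types (u v a : G) (c : G -> G -> int) (P : {set G}).

Definition wt c v : int := (\sum_(u | adj v u) c v u)%R.

Definition in_range (lo hi : nat) (x : int) : Prop := (lo%:Z <= x <= hi%:Z)%R.

(* The state after the vertices of [P] have been treated: an edge is raised when
   its first end is treated and toggled when its second end is. *)
Record valid P c : Prop := Valid {
  valid_sym : forall u v, c u v = c v u;
  valid_range : forall u v, adj u v -> in_range 1 (2 * K + F + 1) (c u v);
  valid_half : forall u v, adj u v -> u \notin P -> in_range (K + 1) (K + F + 1) (c u v);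
  valid_out : forall u v, adj u v -> u \notin P -> v \notin P -> c u v = (K + 1)%:Z;
  valid_disj : forall u v z, u \in P -> v \in P -> v \in ball r u ->
    z \in mate_pair (tau u) (wt c u) -> z \in mate_pair (tau v) (wt c v) -> False }.

Definition shift c v (g : G -> int) (a b : G) : int :=
  (c a b + (if a == v then g b else if b == v then g a else 0))%R.

(** The changes allowed on the edge from [u] to the vertex being treated: a treated [u] must keep
    its weight in its pair, an untreated one permits any raise up to [F]. *)
Definition admissible P c u (x : int) : Prop :=
  if u \in P then x = 0%R \/ x = (mate (tau u) (wt c u) - wt c u)%R
  else (0 <= x <= F%:Z)%R.

Lemma admissible0 P c u : admissible P c u 0.
Proof. by rewrite /admissible; case: ifP => _; [left | rewrite lexx]. Qed.

Lemma wt_shift c v g : wt (shift c v g) v = (wt c v + \sum_(u | adj v u) g u)%R.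
Proof. by rewrite /wt -big_split /=; apply: eq_bigr => u _; rewrite /shift eqxx. Qed.

Lemma wt_shift_neq c v g u : u != v ->
  wt (shift c v g) u = (wt c u + if adj u v then g u else 0)%R.
Proof.
move=> uv; rewrite /wt /shift big_split /= (negPf uv); congr (_ + _)%R.
rewrite -big_mkcondr /=; case: ifP => uvE.
  by rewrite (big_pred1 v) // => b /=; case: eqP => [->|]; rewrite ?andbF ?uvE.
by rewrite big_pred0 // => b; case: eqP => [->|]; rewrite ?andbF ?uvE.
Qed.

(** Pigeonhole: [N + 1] consecutive weights are attainable at [v], while the pairs of the treated
    vertices in the ball exclude at most [N] of them. *)
Lemma greedy_step P c v (cost : G -> nat) (s : seq G) b N :
    valid P c -> v \notin P -> (forall u, tau u <= K) ->
    (forall u, 2 <= cost u) ->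
    (forall u, u \in P -> [|| tau u == tau v, tau v == 0 | 4 <= cost u]) ->
    \sum_(u in P :&: ball r v) cost u <= N ->
    uniq s -> {subset s <= nbh v} -> reach (admissible P c) s b N ->
  exists c', valid (v |: P) c'.
Proof.
move=> [c_sym c_rg c_half c_out c_disj] vP tauK cost2 cost4 costN us sv Hs.
(* A weight [x] of [v] clashes with [u] when [x] or [mate (tau v) x] lies in the pair of [u]. Since
   mates are involutive, [x] is then one of these four values; some coincide when [tau v] is 0 or
   equals [tau u]. *)
pose bad u := let y := wt c u in
  undup [:: y; mate (tau u) y; mate (tau v) y; mate (tau v) (mate (tau u) y)].
have bad_cost u : u \in P -> size (bad u) <= cost u.
  move=> uP; case/or3P: (cost4 u uP) => [/eqP E|/eqP E|/(leq_trans _)->//]; last first.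
  - exact: size_undup.
  - apply: leq_trans (cost2 u); rewrite /bad E !mate0.
    apply: (@uniq_leq_size _ _ [:: wt c u; mate (tau u) (wt c u)]); first exact: undup_uniq.
    by move=> z; rewrite mem_undup !inE; case/or4P => ->; rewrite ?orbT.
  - apply: leq_trans (cost2 u); rewrite /bad E mateK.
    apply: (@uniq_leq_size _ _ [:: wt c u; mate (tau v) (wt c u)]); first exact: undup_uniq.
    by move=> z; rewrite mem_undup !inE; case/or4P => ->; rewrite ?orbT.
pose bads := flatten [seq bad u | u <- enum (P :&: ball r v)].
have badsN : size bads <= N.
  rewrite size_flatten /shape -map_comp sumnE big_map big_enum.
  by apply: leq_trans costN; apply: leq_sum => u; rewrite inE => /andP[/bad_cost].
have [y yN yb] : exists2 y, y <= N & (wt c v + (b + y%:Z))%R \notin bads.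
  apply: contrapT => H.
  pose l := [seq (wt c v + (b + (Posz y)))%R | y <- iota 0 N.+1].
  have : size l <= size bads.
    apply: uniq_leq_size; first by rewrite map_inj_uniq ?iota_uniq // => i j; lia.
    move=> z /mapP[y]; rewrite mem_iota => yN ->; apply: contrapT => /negP Hb.
    by apply: H; exists y.
  by rewrite size_map size_iota; lia.
have [g [okg sg]] := Hs y yN.
pose g' u := if u \in s then g u else 0%R.
have okg' u : admissible P c u (g' u).
  by rewrite /g'; case: ifP => [/okg //|_]; exact: admissible0.
have sg' : (\sum_(u | adj v u) g' u = b + y%:Z)%R.
  rewrite -sg -big_mkcondr (big_uniq _ us) /=; apply: eq_bigl => u.
  by case: (boolP (u \in s)) => [/sv|]; rewrite ?in_nbh ?andbF // => ->.
pose c' := shift c v g'; exists c'.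
have wv : wt c' v = (wt c v + (b + y%:Z))%R by rewrite wt_shift sg'.
have gP u : u \in P -> (`|g' u| <= K%:Z)%R.
  move=> uP; move: (okg' u); rewrite /admissible uP => -[->|->].
    by rewrite normr0.
  by rewrite mate_sub; have := tauK u; lia.
have gN u : u \notin P -> (0 <= g' u <= F%:Z)%R.
  by move=> /negPf uP; move: (okg' u); rewrite /admissible uP.
have pairP u : u \in P -> mate_pair (tau u) (wt c' u) =i mate_pair (tau u) (wt c u).
  move=> uP; have uv : u != v by apply: contraNneq vP => <-.
  apply: mem_mate_pair; rewrite wt_shift_neq //; case: ifP => _; last by rewrite addr0 mem_head.
  by move: (okg' u); rewrite /admissible uP => -[->|->]; rewrite !inE ?addr0 ?eqxx // subrKC eqxx orbT.
have clash u z : u \in P -> u \in ball r v ->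
    z \in mate_pair (tau u) (wt c' u) -> z \in mate_pair (tau v) (wt c' v) -> False.
  move=> uP ub; rewrite pairP // wv => zu zv; move/negP: yb; apply.
  apply/flatten_mapP; exists u; first by rewrite mem_enum inE uP.
  rewrite mem_undup; move: zv zu; rewrite !inE => /orP[/eqP<-|/eqP zE].
    by case/orP => ->; rewrite ?orbT.
  rewrite -[(wt c v + _)%R](mateK (tau v)) -zE !(inj_eq (inv_inj (mateK _))).
  by case/orP => ->; rewrite ?orbT.
split.
- move=> u w; rewrite /c' /shift c_sym; congr (_ + _)%R.
  by case: (eqVneq u v) => [E|_]; case: (eqVneq w v) => [E'|_] //; rewrite E E'.
- move=> u w uw; rewrite /c' /shift.
  (* As [v] was untreated, the edge lies between [K + 1] and [K + F + 1], so a toggle by at most [K]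
     keeps it in range; an edge between two untreated vertices still has colour [K + 1] and is
     raised by at most [F]. *)
  have edge x : adj v x -> in_range 1 (2 * K + F + 1) (c v x + g' x)%R.
    move=> vx; have := c_half _ _ vx vP; rewrite /in_range.
    have [/gP|xP] := boolP (x \in P); first by lia.
    by rewrite (c_out _ _ vx vP xP); have := gN _ xP; lia.
  case: eqP => [E|_]; first by rewrite E in uw *; exact: edge.
  case: eqP => [E|_]; last by rewrite addr0; exact: c_rg.
  by rewrite E in uw *; rewrite c_sym; apply: edge; rewrite adj_sym.
- move=> u w uw; rewrite !inE negb_or => /andP[uv uP].
  rewrite /c' /shift (negPf uv); case: eqP => [E|_]; last by rewrite addr0; exact: c_half.
  by rewrite E in uw *; rewrite (c_out _ _ uw uP vP) /in_range; have := gN _ uP; lia.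
- move=> u w uw; rewrite !inE !negb_or => /andP[uv uP] /andP[wv' wP].
  by rewrite /c' /shift (negPf uv) (negPf wv') addr0; exact: c_out.
- move=> u w z /setU1P[->|uP] /setU1P[->|wP].
  + by rewrite !inE eqxx.
  + by move=> wb zv zw; exact: (clash w z).
  + by rewrite ball_sym => ub zu zv; exact: (clash u z).
  + by move=> wb; rewrite !pairP //; exact: c_disj.
Qed.

(** The next vertex is always an untreated one with least [f], so treated vertices never exceed
    untreated ones in [f]. *)
Lemma greedy (f : G -> nat) :
    (forall P v c, valid P c -> v \notin P ->
      (forall u, u \in P -> f u <= f v) ->
      (forall u, u \notin P -> f v <= f u) ->
      exists c', valid (v |: P) c') ->
  exists c, valid setT c.
Proof.
move=> step.
suff H n : n <= #|G| -> exists P c, [/\ #|P| = n, valid P c &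
    forall u v, u \in P -> v \notin P -> f u <= f v].
  have [P [c [cP vc _]]] := H _ (leqnn _).
  exists c; suff <- : P = setT by [].
  by apply/eqP; rewrite eqEcard subsetT cardsT cP leqnn.
elim: n => [_|n IH nG].
  exists set0, (fun _ _ => (K + 1)%:Z); split=> [|| u v]; rewrite ?cards0 ?inE //.
  split=> //; rewrite /in_range; try lia.
  by move=> u v z; rewrite inE.
have [P [c [cP vc le_f]]] := IH (ltnW nG).
have [v0 v0P] : exists v0, v0 \notin P.
  have : 0 < #|~: P| by rewrite cardsCs finset.setCK cP; lia.
  by case/card_gt0P => v; rewrite inE; exists v.
have [v vP vmin] := @arg_minnP _ v0 (fun x => x \notin P) f v0P.
have [|c' vc'] := step P v c vc vP _ vmin; first by move=> u uP; exact: le_f.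
exists (v |: P), c'; split=> //; first by rewrite cardsU1 vP cP.
move=> u w /setU1P[->|uP]; rewrite !inE negb_or => /andP[_ wP]; first exact: vmin.
exact: le_f.
Qed.

End Greedy.

(** * From symmetric edge functions to the irregularity strength *)

Section Colouring.
Variables (G : sgraph) (r k : nat) (c : G -> G -> int).
Hypothesis (c_sym : forall u v, c u v = c v u).
Hypothesis (c_range : forall u v, adj u v -> in_range 1 k (c u v)).

(** The value is read off an arbitrary ordered pair spanning the set; the symmetry of [c] makes the
    choice immaterial. A set not of the form [[set u; v]] gets 0. *)
Definition edge_value (A : {set G}) : nat :=
  if [pick p : G * G | A == [set p.1; p.2]] is Some p then absz (c p.1 p.2) else 0.

Lemma edge_valueE u v : edge_value [set u; v] = absz (c u v).
Proof.
rewrite /edge_value; case: pickP => [[a b] /= /eqP E|/(_ (u, v))]; last by rewrite eqxx.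
have : u \in [set a; b] by rewrite -E set21.
have : v \in [set a; b] by rewrite -E set22.
have : a \in [set u; v] by rewrite E set21.
have : b \in [set u; v] by rewrite E set22.
rewrite !inE => /orP[]/eqP-> /orP[]/eqP-> //.
- by move=> /orP[]/eqP->.
- by rewrite c_sym.
- by move=> _ /orP[]/eqP->.
Qed.

Lemma wdegree_edge_value v : Posz (wdegree edge_value v) = wt c v.
Proof.
rewrite /wdegree /wt (big_morph Posz PoszD (erefl _)); apply: eq_bigr => u vu.
by rewrite edge_valueE c_sym; have := c_range vu; rewrite /in_range; lia.
Qed.

Lemma strength_le : 0 < k ->
    (forall u v, v \in ball r u -> wt c u <> wt c v) ->
  exists2 s, irregularity_strength r G = Some s & s <= k.
Proof.
move=> k0 H; apply: least_le; split=> //; exists edge_value.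
  by move=> u v uv; rewrite edge_valueE; have := c_range uv; rewrite /in_range; lia.
move=> u v /r_neighbours_ball /H uv E; apply: uv.
by rewrite -!wdegree_edge_value E.
Qed.

End Colouring.

Lemma valid_strength (G : sgraph) r (tau : G -> nat) K F c :
    valid r tau K F setT c ->
  exists2 s, irregularity_strength r G = Some s & s <= 2 * K + F + 1.
Proof.
move=> vc; apply: (strength_le (valid_sym vc) (valid_range vc)); first by rewrite addn1.
move=> u v uv wE; have zu : wt c u \in mate_pair (tau u) (wt c u) by exact: mem_head.
have zv : wt c u \in mate_pair (tau v) (wt c v) by rewrite -wE; exact: mem_head.
exact: (valid_disj vc (in_setT u) (in_setT v) uv zu zv).
Qed.

(* Up to a relative error 1/q, each class contains 1/m of every neighbourhood. *)
Definition balanced (G : sgraph) (m q : nat) (f : G -> nat) : Prop :=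
  forall v i, i < m -> q.-1 * #|nbh v| <=
    q * m * #|[set u in nbh v | f u == i]| <= q.+1 * #|nbh v|.

(** * Greedy colouring along a balanced partition *)

Section BalancedColouring.
Variables (G : sgraph) (r m q J K F : nat) (f : G -> nat).
Hypotheses (fm : forall v, f v < m) (f_bal : balanced m q f).
Hypotheses (q1 : 1 < q) (deg1 : 0 < min_degree G) (Jm : J.+1 < m).
Hypothesis (KJ : 2 ^ J <= K <= 2 ^ J.+1).
(** [cover] lets the raises towards a single later class already span an interval of length [K].
    [room] compares excluded with attainable weights, per neighbour of a vertex of class [i] and
    multiplied by [q * m]. *)
Hypothesis cover : K * (q * m) <= F * q.-1 * min_degree G.
Let E := (\sum_(j < r) max_degree G ^ j) * max_degree G.
Hypothesis room : forall i, i < m ->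
  4 * (q * m) + 2 * E * q.+1 * (i + J + 2) <
  K * q.-1 * (i - J.+1) + F * q.-1 * (m.-1 - i).

(* Classes up to [J] supply the binary steps, the last class needs no step. *)
Definition step (v : G) : nat :=
  if f v <= J then 2 ^ f v else if f v == m.-1 then 0 else K.

(* Bounds the number of weights that the pair of a treated [v] excludes: 4 in
   general, 2 when the later vertex has the same step or the step 0. *)
Definition blocked (v : G) : nat := if f v <= J then 4 else 2.

Lemma card_classes (A : {set G}) a b :
  #|[set u in A | a <= f u < b]| = \sum_(a <= i < b) #|[set u in A | f u == i]|.
Proof.
elim: b => [|b IH].
  by rewrite big_geq // (_ : [set _ | _] = set0) ?cards0 //; apply/setP => u; rewrite !inE ltn0 !andbF.
have [ab|ba] := leqP a b; last first.
  rewrite big_geq // (_ : [set _ | _] = set0) ?cards0 //; apply/setP => u; rewrite !inE.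
  by apply/negbTE; rewrite negb_and orbC; lia.
rewrite big_nat_recr //= -IH -(cardsID [set u | f u == b]) addnC; congr (_ + _); apply: eq_card => u.
  by rewrite !inE; case: (u \in A) => //=; lia.
by rewrite !inE; case: (u \in A) => //=; lia.
Qed.

Lemma card_class_ge v a b : b <= m ->
  (b - a) * (q.-1 * #|nbh v|) <= q * m * #|[set u in nbh v | a <= f u < b]|.
Proof.
move=> bm; rewrite card_classes big_distrr /= -sum_nat_const_nat.
rewrite big_nat_cond [X in _ <= X]big_nat_cond leq_sum // => i /andP[/andP[_ ib] _].
by have /andP[] := f_bal v (leq_trans ib bm).
Qed.

Lemma card_class_le v b : b <= m ->
  q * m * #|[set u in nbh v | f u < b]| <= b * q.+1 * max_degree G.
Proof.
move=> bm; rewrite (_ : [set _ | _] = [set u in nbh v | 0 <= f u < b]) //.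
rewrite card_classes big_distrr /= -mulnA -{2}[b]subn0 -sum_nat_const_nat.
rewrite big_nat_cond [X in _ <= X]big_nat_cond leq_sum // => i /andP[/andP[_ ib] _].
have /andP[_ H] := f_bal v (leq_trans ib bm); apply: (leq_trans H).
by rewrite leq_mul2l card_nbh_max orbT.
Qed.

Lemma card_ball_class_le v b : b <= m ->
  q * m * #|[set u in ball r.+1 v | f u < b]| <=
  #|nbh v| * (q * m + E * q.+1 * b).
Proof.
move=> bm; rewrite (_ : [set _ | _] = ball r.+1 v :&: [set u | f u < b]); last first.
  by apply/setP => u; rewrite !inE.
have H z : q * m * #|nbh z :&: [set u | f u < b]| <= b * q.+1 * max_degree G.
  apply: leq_trans (card_class_le z bm).
  by rewrite leq_mul2l subset_leq_card ?orbT //; apply/subsetP => u; rewrite !inE.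
by have := card_ball_le r v H; rewrite /E; nia.
Qed.

(** The cost is 2 for every treated vertex plus 2 more in the classes up to [J], so two ball counts
    are added, over the first [f v + 1] and the first [J + 1] classes. *)
Lemma blocked_le (P : {set G}) v : (forall u, u \in P -> f u <= f v) ->
  q * m * \sum_(u in P :&: ball r.+1 v) blocked u <=
  #|nbh v| * (4 * (q * m) + 2 * E * q.+1 * (f v + J + 2)).
Proof.
move=> Pv; have H1 := card_ball_class_le v (fm v).
have H2 := card_ball_class_le v (ltnW Jm).
suff : \sum_(u in P :&: ball r.+1 v) blocked u <=
  2 * #|[set u in ball r.+1 v | f u < (f v).+1]| + 2 * #|[set u in ball r.+1 v | f u < J.+1]|.
  nia.
have -> : \sum_(u in P :&: ball r.+1 v) blocked u =
    2 * #|P :&: ball r.+1 v| + 2 * #|[set u in P :&: ball r.+1 v | f u < J.+1]|.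
  rewrite (eq_bigr (fun u => 2 + if f u < J.+1 then 2 else 0)) => [|u _]; last first.
    by rewrite /blocked ltnS; case: ifP.
  rewrite big_split -big_mkcondr /= sum_nat_const mulnC; congr (_ + _).
  rewrite (eq_bigl (mem [set u in P :&: ball r.+1 v | f u < J.+1])) => [|u].
    by rewrite sum_nat_const mulnC.
  by rewrite !inE.
rewrite leq_add // leq_mul2l subset_leq_card //; apply/subsetP => u; rewrite !inE.
  by case/andP => /Pv; rewrite ltnS => -> ->.
by case/andP => /andP[_ ->] ->.
Qed.

Lemma exists_class v j : j < m -> exists2 u, adj v u & f u = j.
Proof.
move=> jm; have /andP[H _] := f_bal v jm.
have : 0 < #|[set u in nbh v | f u == j]|.
  by have := min_degree_le v; case: #|[set _ in _ | _]| H => //; nia.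
by case/card_gt0P => u; rewrite !inE => /andP[vu /eqP]; exists u.
Qed.

Lemma balanced_colouring : exists c, valid r.+1 step K F [set: G] c.
Proof.
apply: (@greedy G r.+1 step K F f) => P v c vc vP Pv nPv.
have ltP u : f u < f v -> u \in P.
  by move=> uv; apply: contraLR uv => /nPv; rewrite -leqNgt.
have gtP u : f v < f u -> u \notin P.
  by move=> uv; apply: contraL uv => /Pv; rewrite -leqNgt.
have m0 : 0 < m by apply: leq_trans Jm.
have qm0 : 0 < q * m by rewrite muln_gt0 m0 ltnW.
have d0 : 0 < #|nbh v| by apply: leq_trans (min_degree_le v).
have stepK u : step u <= K.
  rewrite /step; case: ifP => [uJ|_]; last by case: ifP.
  by case/andP: KJ => KJ1 _; apply: leq_trans KJ1; rewrite leq_exp2l.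
have stepB u : J < f u < m.-1 -> step u = K.
  by case/andP => Ju um; rewrite /step leqNgt Ju /= ltn_eqF.
have toggle u : u \in P -> exists a d,
    [/\ admissible step F P c u a, admissible step F P c u (a + d)%R & `|d|%N = step u].
  move=> uP; exists 0%R, (mate (step u) (wt c u) - wt c u)%R; split.
  - exact: admissible0.
  - by rewrite /admissible uP add0r; right.
  - by have := mate_sub (step u) (wt c u); lia.
suff [s [b [N [us sv Hs HN]]]] : exists s b N, [/\ uniq s, {subset s <= nbh v},
    reach (admissible step F P c) s b N &
    #|nbh v| * (K * q.-1 * (f v - J.+1) + F * q.-1 * (m.-1 - f v)) <= q * m * N].
  apply: (greedy_step (cost := blocked) vc vP _ _ _ _ us sv Hs) => //.
  - by move=> u; rewrite /blocked; case: ifP.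
  (* For [f u > J] also [f v > J]: either [v] is in the last class and has step 0, or both classes
     lie strictly between [J] and [m.-1] and both steps are [K]. *)
  - move=> u /Pv uv; rewrite /blocked /step; have := fm v; case: (leqP (f u) J) => [|Ju].
      by rewrite !orbT.
    have -> : f v <= J = false by lia.
    move=> vm; have [vE|/eqP vE] := eqVneq (f v) m.-1; first by rewrite orbT.
    have -> : f u == m.-1 = false by lia.
    by rewrite eqxx.
  - have H1 := blocked_le Pv; have H2 := room (fm v).
    rewrite -(leq_pmul2l qm0); apply: leq_trans H1 (leq_trans _ HN).
    by rewrite leq_mul2l ltnW ?orbT.
pose B := [set u in nbh v | J.+1 <= f u < f v].
have HB := card_class_ge v J.+1 (ltnW (fm v)); rewrite -/B in HB.
have BP u : u \in enum B -> [/\ adj v u, J < f u < m.-1 & u \in P].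
  rewrite mem_enum !inE => /andP[vu /andP[Ju uv]]; split=> //; last exact: ltP.
  by have := fm v; lia.
have toggleB u : u \in enum B -> exists a d,
    [/\ admissible step F P c u a, admissible step F P c u (a + d)%R & `|d|%N = K].
  by case/BP => _ /stepB <- /toggle.
(* Before the last class, raises towards [A] give an initial interval long enough for the toggles by
   [K] in [B]; [A] contains at least one whole class, so [cover] applies. *)
have [vm|vm] := ltnP (f v) m.-1.
  pose A := [set u in nbh v | (f v).+1 <= f u < m].
  have HA := card_class_ge v (f v).+1 (leqnn m); rewrite -/A in HA.
  have AP u : u \in enum A -> adj v u /\ u \notin P.
    by rewrite mem_enum !inE => /andP[vu /andP[uv _]]; split=> //; exact: gtP.
  have us : uniq (enum B ++ enum A).
    rewrite cat_uniq !enum_uniq andbT /=; apply/hasPn => u /AP[_ uP].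
    by apply: contra uP => /BP[].
  have coverA : K <= F * #|A|.
    have h : q.-1 * #|nbh v| <= q * m * #|A|.
      by apply: leq_trans HA; rewrite leq_pmull //; lia.
    rewrite -(leq_pmul2r qm0); apply: leq_trans cover _.
    apply: leq_trans (_ : F * q.-1 * #|nbh v| <= _).
      by rewrite leq_mul2l min_degree_le orbT.
    by rewrite -mulnA -[F * #|A| * _]mulnA leq_mul2l [#|A| * _]mulnC h orbT.
  have [||b Hb] := @reach_cat _ (admissible step F P c) K (enum B) (enum A) 0
      (F * size (enum A)) us _ _ toggleB.
  - by rewrite -cardE; exact: leqW.
  - by apply: reach_interval => [|u x /AP[_ /negPf uP] x0]; rewrite ?enum_uniq // /admissible uP.
  exists (enum B ++ enum A), b, (F * size (enum A) + K * size (enum B)); split=> //.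
    by move=> u; rewrite mem_cat in_nbh => /orP[/BP[]|/AP[]].
  rewrite -!cardE; have := leq_mul (leqnn F) HA; have := leq_mul (leqnn K) HB.
  have -> : m - (f v).+1 = m.-1 - f v by lia.
  lia.
(* In the last class, one neighbour from each class up to [J] supplies the step [2 ^ j]; together
   they attain [2 ^ J.+1 >= K] values. Beyond [J] the value [v] of [h] is a dummy. *)
have /choice[h Hh] : forall j, exists u, j <= J -> adj v u /\ f u = j.
  move=> j; have [jJ|_] := leqP j J; last by exists v.
  by have [u] := exists_class v (ltn_trans (jJ : j < J.+1) Jm); exists u.
have vE : f v = m.-1 by have := fm v; lia.
have hP j : j <= J -> [/\ adj v (h j), f (h j) = j & h j \in P].
  by move=> jJ; have [? fj] := Hh j jJ; split=> //; apply: ltP; lia.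
have [||b1 Hb1] := @reach_binary _ (admissible step F P c) J.+1 h.
- move=> i j; rewrite !inE !ltnS => /hP[_ fi _] /hP[_ fj _] hE.
  by rewrite -fi -fj hE.
- move=> j; rewrite ltnS => jJ; have [_ fj jP] := hP j jJ.
  by have [a [d [? ? dE]]] := toggle _ jP; exists a, d; split=> //; rewrite dE /step fj jJ.
have inA u : u \in rev [seq h j | j <- iota 0 J.+1] -> adj v u /\ f u <= J.
  rewrite mem_rev => /mapP[j]; rewrite mem_iota add0n ltnS => /= jJ ->.
  by have [? -> _] := hP j jJ.
have us : uniq (enum B ++ rev [seq h j | j <- iota 0 J.+1]).
  rewrite cat_uniq enum_uniq rev_uniq andTb map_inj_in_uniq ?iota_uniq ?andbT.
    by apply/hasPn => u /inA[_ uJ]; apply/negP => /BP[_]; lia.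
  move=> i j; rewrite !mem_iota !add0n !ltnS /=.
  by move=> /hP[_ fi _] /hP[_ fj _] hE; rewrite -fi -fj hE.
have [|b Hb] := reach_cat us _ Hb1 toggleB.
  by case/andP: KJ => _; rewrite prednK ?expn_gt0.
exists (enum B ++ rev [seq h j | j <- iota 0 J.+1]), b.
exists ((2 ^ J.+1).-1 + K * size (enum B)); split=> //.
  by move=> u; rewrite mem_cat in_nbh => /orP[/BP[]|/inA[]].
rewrite -cardE [X in _ <= X]mulnDr; apply: leq_trans (leq_addl _ _).
rewrite vE in HB *; rewrite subnn muln0 addn0.
by have := leq_mul (leqnn K) HB; lia.
Qed.

End BalancedColouring.

(** * Choice of the parameters *)

(* Both sides are affine in [i] beyond [j.-1], and below it [i = j.-1] is the
   worst case; so the comparison is only needed at [j.-1] and at [m.-1]. *)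
Lemma affine_room (A B C Z m j i : nat) : 0 < j -> j < m -> i < m ->
  Z + C * (2 * j) < B * (m - j) ->
  Z + C * (m - j + 2 * j) < A * (m - j) ->
  Z + C * (i + j) < A * (i - j.-1) + B * (m.-1 - i).
Proof.
move=> j0 jm im P0 P1; have [ij|ji] := leqP i j.-1.
  have h1 : C * (i + j) <= C * (2 * j) by rewrite leq_mul2l; lia.
  have h2 : B * (m - j) <= B * (m.-1 - i) by rewrite leq_mul2l; lia.
  by lia.
set X := m - j in P0 P1; set x := i - j.-1.
have X0 : 0 < X by rewrite /X; lia.
have xX : x <= X by rewrite /x /X; lia.
have -> : m.-1 - i = X - x by rewrite /x /X; lia.
have h : C * (i + j) <= C * (x + 2 * j) by rewrite leq_mul2l /x; lia.
(* Linear interpolation: [X] times the claim is [X - x] times the inequality at one end plus [x]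
   times that at the other. *)
rewrite -(ltn_pmul2l X0).
have Q0 : (X - x) * (Z + C * (2 * j)).+1 <= (X - x) * (B * X) by rewrite leq_mul2l P0 orbT.
have Q1 : x * (Z + C * (X + 2 * j)).+1 <= x * (A * X) by rewrite leq_mul2l P1 orbT.
have [y yE] : exists y, X = x + y by exists (X - x); lia.
rewrite yE addKn in Q0 Q1 X0 *; nia.
Qed.

(** The geometric sum times [Delta - 1] is [Delta ^ s - 1]; hence the number of far walks exceeds
    [Delta ^ s] by a relative error of at most [1 / (Delta - 1)]. *)
Lemma geometric_tail (Delta s : nat) : 0 < Delta ->
  (\sum_(j < s) Delta ^ j) * Delta * Delta.-1 <= Delta * Delta ^ s.
Proof.
case: Delta => // d _; rewrite -mulnA [_.+1 * _]mulnC mulnA mulnC leq_mul2l /=.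
elim: s => [|s IH]; first by rewrite big_ord0.
by rewrite big_ord_recr /= mulnDl expnS; nia.
Qed.

(** With [q = p + 1], [2 E (q + 1)] is at most [2 D q + 4 D + 2 D / q], and [K (q - 1)] is at least
    [2 D q + 30 D - 32 D / q]. The difference [26 D - 34 D / q] is at least [25 D] once
    [q >= 34]. *)
Lemma slack (p E D K : nat) : 34 <= p.+1 -> p.+1 * E <= p.+2 * D ->
  2 * D * p.+1 + 32 * D <= K * p.+1 -> 2 * E * p.+2 + 25 * D <= K * p.
Proof.
move=> p34 E1 Kq; rewrite -(leq_pmul2l (ltn0Sn p)).
have e1 : 2 * p.+2 * (p.+1 * E) <= 2 * p.+2 * (p.+2 * D) by rewrite leq_mul2l E1 orbT.
have e2 : (2 * D * p.+1 + 32 * D) * p <= K * p.+1 * p by rewrite leq_mul2r Kq orbT.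
have e3 : 34 * D <= p.+1 * D by rewrite leq_mul2r p34 orbT.
lia.
Qed.

Section Choice.
Variables (s Delta delta l : nat).
Hypotheses (s0 : 0 < s) (l_large : 4096 * (2 * s + 1) <= l).
Hypothesis (l_log : 2 ^ l <= Delta < 2 ^ l.+1).
Hypothesis (delta_large : l ^ 8 <= 256 * delta).

Let D := Delta ^ s.
Let m := l ^ 3.
Let q := 32 * l.
Let K := 2 * D + D %/ l + 1.
Let F := D %/ l + 1.
Let J := trunc_log 2 K.
Let E := (\sum_(j < s) Delta ^ j) * Delta.

Lemma l_ge : 4096 <= l. Proof. lia. Qed.

Lemma Delta_ge : 128 * l < Delta.
Proof.
have /andP[H _] := l_log; apply: leq_trans H.
have l8 := l_ge; have l8' : 8 <= l by lia.
have := ltn_expl (l - 8) (isT : 1 < 2); have -> : 2 ^ l = 2 ^ (l - 8) * 2 ^ 8 by rewrite -expnD subnK.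
lia.
Qed.

Lemma D_ge : Delta <= D.
Proof. by rewrite /D -(prednK s0) expnS leq_pmulr // expn_gt0; have := Delta_ge; lia. Qed.

(** With [x = 2 ^ l], the class number is at most [x ^ 3] and [Delta < 2 x], so the left side is at
    most [32 x ^ 5]. *)
Lemma splitting_params : 8 * m * (Delta ^ 2).+1 <= 2 ^ (8 * l).
Proof.
have /andP[_ H] := l_log; have ll := ltn_expl l (isT : 1 < 2).
have -> : 2 ^ (8 * l) = (2 ^ l) ^ 8 by rewrite -expnM mulnC.
rewrite expnS in H; set x := 2 ^ l in H ll *.
have lx : l ^ 3 <= x ^ 3 by rewrite leq_exp2r // ltnW.
have Dx : (Delta ^ 2).+1 <= 4 * x ^ 2.
  rewrite -[4]/(2 ^ 2) -expnMn; rewrite ltn_exp2r //.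
have x32 : 32 <= x ^ 3.
  by rewrite (leq_trans _ lx) // (@leq_trans (4096 ^ 3)) // leq_exp2r // l_ge.
rewrite /m; apply: leq_trans (_ : 8 * x ^ 3 * (4 * x ^ 2) <= _).
  by rewrite leq_mul // leq_mul.
have -> : x ^ 8 = x ^ 3 * (x ^ 3 * x ^ 2) by rewrite -!expnD.
have -> : 8 * x ^ 3 * (4 * x ^ 2) = x ^ 3 * (32 * x ^ 2) by ring.
by rewrite leq_mul2l leq_mul2r x32 !orbT.
Qed.

(** The left side is [2 ^ 16 * l ^ 6]; two powers of [l >= 2 ^ 12] absorb the constant [2 ^ 24] that
    arises with the factor 256. *)
Lemma degree_params : 8 * q ^ 2 * m * (8 * l) <= delta.
Proof.
suff : 256 * (8 * q ^ 2 * m * (8 * l)) <= 256 * delta by rewrite leq_pmul2l.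
apply: leq_trans delta_large; rewrite /q /m.
have -> : 256 * (8 * (32 * l) ^ 2 * l ^ 3 * (8 * l)) = 4096 ^ 2 * l ^ 6.
  by rewrite expnMn; lia.
by rewrite (expnD l 2 6) leq_mul2r leq_exp2r // l_ge orbT.
Qed.

Lemma K_le : K <= 4 * D.
Proof.
have := leq_div D l; have := D_ge; have := Delta_ge; rewrite /K.
by lia.
Qed.

Lemma J_bounds : 2 ^ J <= K <= 2 ^ J.+1.
Proof.
have K0 : 0 < K by rewrite /K addn1.
by have /andP[-> /ltnW] := trunc_log_bounds (isT : 1 < 2) K0.
Qed.

(** Since [K <= 4 * Delta ^ s], [J] is linear in [l] with a factor depending on [s], so the binary
    classes are a negligible part of the [l ^ 3] classes. *)
Lemma J_small : 4096 * (J + 3) <= l ^ 2.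
Proof.
have J1 : J <= 2 + l.+1 * s.
  have /andP[_ H] := l_log; have /andP[J2 _] := J_bounds.
  rewrite -(@leq_exp2l 2) // (leq_trans J2) // (leq_trans K_le) // expnD leq_mul2l /=.
  by rewrite expnM leq_exp2r // ltnW.
have h : J + 3 <= l * (2 * s + 1) by have := l_ge; nia.
rewrite -mulnn; apply: leq_trans (_ : l * (4096 * (2 * s + 1)) <= _).
  by rewrite mulnCA leq_mul2l h.
by rewrite leq_mul2l l_large orbT.
Qed.

Lemma Fl_ge : D <= F * l.
Proof.
have l0 : 0 < l by have := l_ge; lia.
by rewrite /F addn1 ltnW // ltn_ceil.
Qed.

Lemma cover_params : K * (q * m) <= F * q.-1 * delta.
Proof.
have l0 := l_ge; have H := degree_params; have FD := Fl_ge.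
apply: leq_trans (_ : 4 * D * (q * m) <= _); first by rewrite leq_mul2r K_le orbT.
apply: leq_trans (_ : 4 * (F * l) * (q * m) <= _); first by rewrite !leq_mul2r leq_mul2l FD !orbT.
apply: leq_trans (_ : F * q.-1 * (q * m * l ^ 1 * 4) <= _).
  rewrite -!mulnA [4 * _]mulnC -!mulnA leq_mul2l; apply/orP; right.
  have : 1 <= q.-1 by rewrite /q; lia.
  by move=> q1; rewrite expn1; apply: leq_trans (leq_pmull _ q1); lia.
rewrite leq_mul2l; apply/orP; right; apply: leq_trans H.
by rewrite expn1 expnS expn1; have : 0 < q; rewrite /q; nia.
Qed.

Lemma room_params i : i < m ->
  4 * (q * m) + 2 * E * q.+1 * (i + J + 2) <
  K * q.-1 * (i - J.+1) + F * q.-1 * (m.-1 - i).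
Proof.
(* This is the form of [affine_room] with [j = J.+2]. *)
move=> im; rewrite -addnA -addn2 [J + 1.+1]addn2 -[J.+1]/(J.+2.-1).
have l0 := l_ge; have HJ := J_small; have HD := D_ge; have HDe := Delta_ge.
have HF := Fl_ge.
have mE : m = l ^ 2 * l by rewrite /m expnSr.
have jm : 4096 * J.+2 <= m by rewrite mE; nia.
have q34 : 34 <= q by rewrite /q; lia.
have Kq : 2 * D * q + 32 * D <= K * q by rewrite /K /q -/F; have := HF; rewrite /F; nia.
(* As [q <= Delta.-1], the relative error from [geometric_tail] is at most [1 / q]. *)
have E1 : q * E <= q.+1 * D.
  have H : E * Delta.-1 <= Delta * D by apply: geometric_tail; lia.
  have [ED|/ltnW DE] := leqP E D; first by rewrite leq_mul.
  have qD : q <= Delta.-1 by rewrite /q; lia.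
  have [e eE] : exists e, E = D + e by exists (E - D); lia.
  have [d dE] : exists d, Delta = d.+1 by exists Delta.-1; lia.
  rewrite eE dE /= in H qD *.
  have : e * q <= e * d by rewrite leq_mul2l qD orbT.
  nia.
have E2 : E <= 2 * D.
  have q0 : 0 < q by lia.
  by rewrite -(leq_pmul2l q0) (leq_trans E1) // mulnA leq_mul2r; lia.
(* Write [X = m - J.+2]. The terms [Zm] and [Cj] are each at most [D * m <= 2 * D * X], together
   [4 * D * X]; the margins are [31 * D * X] at the first classes and [25 * D * X] at the last. *)
have B1 : 31 * D <= F * q.-1 by rewrite /q; nia.
have Zm : 4 * (q * m) <= D * m.
  by rewrite mulnA leq_mul2r; apply/orP; right; rewrite /q; lia.
have Cj : 2 * E * q.+1 * (2 * J.+2) <= D * m.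
  apply: leq_trans (_ : 4 * D * (33 * l) * (2 * J.+2) <= _).
    by rewrite leq_mul2r; apply/orP; right; apply: leq_mul; [lia | rewrite /q; lia].
  have -> : 4 * D * (33 * l) * (2 * J.+2) = D * (264 * J.+2 * l) by ring.
  by rewrite leq_mul2l mE leq_mul2r; lia.
have A1 : 2 * E * q.+1 + 25 * D <= K * q.-1.
  have [p pE] : exists p, q = p.+1 by exists q.-1; lia.
  by rewrite pE in E1 Kq q34 *; exact: slack.
have X1 : D * m <= 2 * (D * (m - J.+2)).
  by rewrite mulnCA leq_mul2l; lia.
have X0 : 0 < D * (m - J.+2) by rewrite muln_gt0; lia.
have BX := leq_mul B1 (leqnn (m - J.+2)).
have AX := leq_mul A1 (leqnn (m - J.+2)).
apply: affine_room => //; first lia.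
- by apply: leq_trans BX; rewrite -mulnA; lia.
- by rewrite mulnDl -[25 * D * _]mulnA in AX; rewrite mulnDr; lia.
Qed.

End Choice.

(** * A crude bound for small maximum degree *)

(** Greedy: a vertex is removed, the rest coloured, and at most [n] of the [n + 1] colours are then
    forbidden for it. *)
Lemma proper_colouring (T : finType) (e : rel T) n :
    symmetric e -> (forall v, #|[set u | e v u]| <= n) ->
  exists psi : T -> 'I_n.+1, forall u v, u != v -> e u v -> psi u != psi v.
Proof.
move=> e_sym en.
suff H k (P : {set T}) : #|P| <= k -> exists psi : T -> 'I_n.+1,
    {in P &, forall u v, u != v -> e u v -> psi u != psi v}.
  have [psi Hpsi] := H _ setT (leqnn _).
  by exists psi => u v; apply: Hpsi; rewrite inE.
elim: k P => [|k IH] P.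
  rewrite leqn0 cards_eq0 => /eqP->; exists (fun=> ord0) => u v; by rewrite inE.
have [->|[v vP]] := set_0Vmem P; first by exists (fun=> ord0) => u v; rewrite inE.
rewrite (cardsD1 v) vP ltnS => /IH[psi Hpsi].
have : 0 < #|~: (psi @: [set u | e v u])|.
  rewrite cardsCs finset.setCK card_ord subn_gt0 ltnS.
  exact: leq_trans (leq_imset_card _ _) (en v).
case/card_gt0P => i; rewrite inE => iN.
have new u : e v u -> psi u != i.
  by move=> vu; apply: contraNneq iN => <-; apply: imset_f; rewrite inE.
exists (fun u => if u == v then i else psi u) => u w uP wP.
have [->|uv] := eqVneq u v; have [->|wv] := eqVneq w v; rewrite ?eqxx // => uw ew.
- by rewrite eq_sym new.
- by rewrite new // e_sym.
- by apply: Hpsi; rewrite // !inE ?uv ?wv.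
Qed.

Lemma odd_binary (n x : nat) (b : nat -> bool) : x < n ->
  odd ((\sum_(i < n) b i * 2 ^ i) %/ 2 ^ x) = b x.
Proof.
elim: n x b => // n IH x b xn; rewrite big_ord_recl /= expn0 muln1.
under eq_bigr => i _ do rewrite /bump /= add1n expnS mulnCA.
rewrite -big_distrr /= addnC mulnC; case: x xn => [_|x].
  by rewrite expn0 divn1 oddD oddM andbF; case: (b 0).
rewrite ltnS => xn; rewrite expnS divnMA divnMDl // -(IH _ (fun i => b i.+1) xn).
by rewrite (_ : b 0 %/ 2 = 0) ?addn0 //; case: (b 0).
Qed.

Lemma sum_exp2_inj n (A B : {set 'I_n}) :
  \sum_(i in A) 2 ^ i = \sum_(i in B) 2 ^ i -> A = B.
Proof.
have bits (C : {set 'I_n}) (x : 'I_n) : odd ((\sum_(i in C) 2 ^ i) %/ 2 ^ x) = (x \in C).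
  pose b i := if insub i is Some j then (j : 'I_n) \in C else false.
  transitivity (b x); last by rewrite /b valK.
  rewrite -(odd_binary b (ltn_ord x)); congr (odd (_ %/ _)).
  rewrite big_mkcond /=; apply: eq_bigr => i _.
  by rewrite /b valK; case: (i \in C); rewrite ?mul1n.
by move=> E; apply/setP => x; rewrite -!bits E.
Qed.

Section Crude.
Variables (r : nat) (G : sgraph).
Hypothesis r0 : 0 < r.
Implicit Types (u v a b : G).

Definition ball_bound (Delta : nat) : nat :=
  Delta + Delta * (\sum_(j < r) Delta ^ j) * Delta.

Lemma card_ball_bound v : #|ball r.+1 v| <= ball_bound (max_degree G).
Proof.
have H (z : G) : 1 * #|nbh z :&: setT| <= max_degree G.
  by rewrite mul1n setIT card_nbh_max.
have := card_ball_le r v H; rewrite !mul1n setIT => /leq_trans; apply.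
by rewrite leq_add ?card_nbh_max // !leq_mul ?card_nbh_max.
Qed.

Lemma adj_ball u v : adj u v -> v \in ball r.+1 u.
Proof.
move=> uv; apply: (@walk_ends_ball _ _ _ _ 1) => //.
  by apply: contraTneq uv => ->; rewrite adj_irr.
by apply/walk_ends_path; exists [:: v]; rewrite /= uv.
Qed.

Lemma ball_adj u v a : v \in ball r u -> adj u a -> v != a -> v \in ball r.+1 a.
Proof.
rewrite in_setD1 => /andP[_ /bigcupP[j _ /walk_ends_path[p [pp lp sp]]]] ua va.
apply: (@walk_ends_ball _ _ _ _ j.+2) => //; first exact: (ltn_ord j).
apply/walk_ends_path; exists (u :: p); rewrite /= lp sp adj_sym ua pp; by split.
Qed.

Lemma ball_neighbour u v : v \in ball r u -> exists a, adj u a.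
Proof.
rewrite in_setD1 => /andP[_ /bigcupP[j _ /walk_ends_path[[|a p] [pp _ //]]]].
by case/andP: pp; exists a.
Qed.

Hypothesis noK2 : no_isolated_edge G.

(* The neighbours of [v] have distinct colours other than that of [v], so that
   the binary digits of the weighted degree of [v] list the pairs of colours on
   the edges at [v]. *)
Lemma strength_crude :
  exists2 k, irregularity_strength r G = Some k &
    k <= 2 ^ (2 ^ (ball_bound (max_degree G)).+1).
Proof.
have [psi psiP] : exists psi : G -> 'I_(ball_bound (max_degree G)).+1,
    forall u v, u != v -> v \in ball r.+1 u -> psi u != psi v.
  apply: proper_colouring => [u v|v]; first exact: ball_sym.
  apply: leq_trans (card_ball_bound v); apply: subset_leq_card.
  by apply/subsetP => u; rewrite inE.
set n := _.+1 in psi psiP *.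
pose g v a := enum_rank [set psi v; psi a].
(* The exponent is the rank of the set of end colours among all [2 ^ n] sets of colours, which
   yields the double exponential. *)
pose col (A : {set G}) := 2 ^ enum_rank (psi @: A).
have colE v a : col [set a; v] = 2 ^ g v a.
  by rewrite /col /g imsetU1 imset_set1 setUC.
have psi_adj v a : adj v a -> psi v != psi a.
  move=> va; apply: psiP; last exact: adj_ball.
  by apply: contraTneq va => ->; rewrite adj_irr.
have g_inj v : {in nbh v &, injective (g v)}.
  move=> a b; rewrite !in_nbh => va vb /enum_rank_inj ab.
  have := set22 (psi v) (psi a); rewrite ab !inE eq_sym (negPf (psi_adj _ _ va)) /= => /eqP E.
  apply/eqP; apply: contraTT (eqxx (psi a)) => nab; rewrite {2}E; apply: psiP => //.
  apply: (@walk_ends_ball _ _ _ _ 2); rewrite 1?eq_sym //.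
  by apply/walk_ends_path; exists [:: v; b]; rewrite /= adj_sym va vb.
have wE v : wdegree col v = \sum_(x in g v @: nbh v) 2 ^ x.
  rewrite big_imset; last exact: g_inj.
  by apply: eq_big => [a|a _]; rewrite ?in_nbh ?colE.
apply: least_le; split; first by rewrite expn_gt0.
exists col.
  move=> u v uv; rewrite colE expn_gt0 leq_exp2l //= ltnW //.
  by rewrite (leq_trans (ltn_ord _)) // -cardsT -powersetT card_powerset cardsT card_ord.
move=> u v /r_neighbours_ball uv; rewrite !wE => /sum_exp2_inj E.
(* If [x] and [y] have equal weights, the colour pair of the edge [xa] occurs at [y] and so contains
   [psi y]. As [psi y] differs from [psi x], it equals [psi a]; but [a] and [y] are close, so
   [a = y]. Applied both ways, this makes [uv] an isolated edge. *)
have only x y a : y \in ball r x -> g x @: nbh x = g y @: nbh y -> adj x a -> a = y.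
  move=> xy Exy xa; have : g x a \in g y @: nbh y by rewrite -Exy imset_f ?in_nbh.
  case/imsetP => b yb /enum_rank_inj ab.
  have := set21 (psi y) (psi b); rewrite -ab !inE.
  have yx : x != y by apply: contraTneq xy => ->; rewrite !inE eqxx.
  have -> : psi y == psi x = false.
    apply/negbTE; rewrite eq_sym; apply: psiP => //.
    move: xy; rewrite !in_setD1 => /andP[-> /bigcupP[j _ Hj]].
    by apply/bigcupP; exists (widen_ord (leqnSn r) j).
  move=> /= /eqP pya; apply/eqP; apply: contraTT (eqxx (psi a)) => ay.
  by rewrite -{2}pya; apply: psiP => //; apply: (ball_adj xy xa); rewrite eq_sym.
have vu : u \in ball r v by rewrite ball_sym.
have [a ua] := ball_neighbour uv.
have uvA : adj u v by rewrite -(only u v a uv E ua).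
apply: (noK2 uvA); apply/setP => w; rewrite !inE; apply/idP/orP; last first.
  by case=> /eqP->; [exact: connect0 | exact: connect1].
case/connectP => p pp ->; elim/last_ind: p pp => [|p x IH]; first by left.
rewrite rcons_path last_rcons => /andP[/IH[]/eqP-> xA].
  by right; rewrite (only u v x).
by left; rewrite (only v u x).
Qed.

End Crude.

(** * The local lemma *)

Section LocalLemma.
Variables (I Omega : finType) (A : I -> {set Omega}).

Implicit Type S : {set I}.

Definition avoid S : {set Omega} := [set w | [forall j in S, w \notin A j]].

Lemma avoidU1 i S : avoid (i |: S) = avoid S :\: A i.
Proof.
apply/setP => w; rewrite in_setD !inE; apply/forall_inP/andP => [H|[wi H] j].
  split; first exact/H/setU11.
  by apply/forall_inP => j jS; apply: H; rewrite setU1r.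
by case/setU1P => [->//|jS]; exact: (forall_inP H).
Qed.

Lemma avoidS S S' : S' \subset S -> avoid S \subset avoid S'.
Proof.
move=> /subsetP sS; apply/subsetP => w; rewrite !inE => /forall_inP H.
by apply/forall_inP => j /sS; exact: H.
Qed.

Variables (nb : I -> {set I}) (q D : nat).
Hypotheses (q_gt2 : 2 < q) (Dq : 4 * D <= q) (nbD : forall i, #|nb i| <= D).
(** Probabilities are ratios of cardinalities. Independence is used only in this form: given that
    events outside [nb i] are avoided, [A i] has probability at most [1 / q]. *)
Hypothesis indep : forall i S, [disjoint S & nb i] ->
  q * #|A i :&: avoid S| <= #|avoid S|.

(** Induction on the size of [S]. Given that [S2], the part of [S] outside [nb i], is avoided, each
    of the at most [D] other events has probability at most [2 / q], so together at most 1/2.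
    Avoiding them too at most halves the space, which turns [1 / q] into [2 / q]. *)
Lemma conditional_bound S i : q * #|A i :&: avoid S| <= 2 * #|avoid S|.
Proof.
have [n] := ubnP #|S|; elim: n S i => // n IH S i; rewrite ltnS => Sn.
have [S0|S0] := eqVneq (S :&: nb i) set0.
  apply: leq_trans (indep _) _; last lia.
  by rewrite -setI_eq0 S0.
pose S2 := S :\: nb i.
have S2lt : #|S2| < n.
  apply: leq_trans _ Sn; rewrite -(cardsID (nb i) S) -addn1 addnC leq_add2r.
  by rewrite card_gt0.
have H1 : #|avoid S2| <= #|avoid S| + \sum_(j in S :&: nb i) #|A j :&: avoid S2|.
  apply: leq_trans (_ : #|avoid S :|: \bigcup_(j in S :&: nb i) A j :&: avoid S2| <= _);
    last by apply: leq_trans (leq_card_setU _ _) _; rewrite leq_add2l card_bigcup_le.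
  apply: subset_leq_card; apply/subsetP => w wS2; rewrite in_setU orbC.
  case: (boolP (w \in avoid S)) => [_|]; first by rewrite orbT.
  rewrite inE negb_forall_in => /exists_inP[j jS /negbNE wj].
  apply/orP; left; rewrite inE wS2 andbT; apply/bigcupP; exists j; last exact: wj.
  rewrite inE jS /=; apply: contraLR wj => jn.
  by move: wS2; rewrite inE => /forall_inP; apply; rewrite inE jn.
have H2 : q * \sum_(j in S :&: nb i) #|A j :&: avoid S2| <= 2 * D * #|avoid S2|.
  rewrite big_distrr; apply: leq_trans (leq_sum _ (fun j _ => IH S2 j S2lt)) _.
  rewrite sum_nat_const mulnA leq_mul2r mulnC leq_mul2l /= orbC.
  by rewrite (leq_trans (subset_leq_card (subsetIr _ _)) (nbD i)).
have H3 : q * #|A i :&: avoid S| <= #|avoid S2|.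
  apply: leq_trans (indep _).
    rewrite leq_mul2l; apply/orP; right.
    exact/subset_leq_card/setIS/avoidS/subsetDl.
  by rewrite -setI_eq0 setIDAC setIC setDIl setDv set0I.
nia.
Qed.

(** The events are excluded one at a time; each removes at most the fraction [2 / q < 1] of what
    remains. *)
Lemma local_lemma : 0 < #|Omega| -> exists w, forall i, w \notin A i.
Proof.
move=> Om; suff : 0 < #|avoid setT|.
  by case/card_gt0P => w; rewrite inE => /forall_inP H; exists w => i; exact: H.
suff H n S : #|S| <= n -> 0 < #|avoid S| by exact: H (leqnn _).
elim: n S => [|n IH] S.
  rewrite leqn0 cards_eq0 => /eqP->.
  rewrite (_ : avoid _ = setT) ?cardsT //; apply/setP => w; rewrite !inE.
  by apply/forall_inP => j; rewrite inE.
have [->|[i iS]] := set_0Vmem S; first by rewrite cards0 => _; apply: IH; rewrite cards0.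
rewrite (cardsD1 i) iS ltnS -{2}(setD1K iS) => /IH.
set S1 := S :\ i.
rewrite avoidU1; have := conditional_bound S1 i; have := cardsID (A i) (avoid S1).
by rewrite [A i :&: _]setIC; nia.
Qed.

End LocalLemma.

(** * Random balanced partitions *)

From mathcomp Require Import all_classical all_reals all_analysis.
Import numFieldNormedType.Exports.

Local Open Scope ring_scope.

Section Independence.
Variables (R : comPzRingType) (V Y : finType) (M : {set V}).
Local Notation Omega := {ffun V -> Y}.

Definition glue (a b : Omega) : Omega := [ffun u => if u \in M then a u else b u].

(* Swapping the coordinates in [M] of two independent samples preserves the
   uniform measure on pairs. *)
Lemma sum_independent (C : {set Omega}) (g : Omega -> R) :
    (forall a b : Omega, (forall u, u \notin M -> a u = b u) -> (a \in C) = (b \in C)) ->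
    (forall a b : Omega, (forall u, u \in M -> a u = b u) -> g a = g b) ->
  #|[set: Omega]|%:R * \sum_(w in C) g w = #|C|%:R * \sum_w g w.
Proof.
move=> HC Hg.
pose swap (p : Omega * Omega) := (glue p.2 p.1, glue p.1 p.2).
have swapK : involutive swap.
  by case=> a b; rewrite /swap /=; congr (_, _); apply/ffunP => u;
    rewrite !ffunE; case: (u \in M).
have pairE (F : Omega -> Omega -> R) :
    \sum_(p : Omega * Omega | p.1 \in C) F p.1 p.2 = \sum_(a in C) \sum_b F a b.
  by rewrite pair_big_dep; apply: eq_bigl => p; rewrite andbT.
transitivity (\sum_(p : Omega * Omega | p.1 \in C) g p.1).
  rewrite (pairE (fun a _ => g a)).
  rewrite mulr_sumr; apply: eq_bigr => a _.
  by rewrite sumr_const mulr_natl cardsT.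
rewrite (reindex_inj (inv_inj swapK)) /=.
transitivity (\sum_(p : Omega * Omega | p.1 \in C) g p.2).
  apply: eq_big => [p|p _].
    by apply: HC => u /negPf uM; rewrite ffunE uM.
  by apply: Hg => u uM; rewrite ffunE uM.
rewrite (pairE (fun _ b => g b)).
by rewrite sumr_const mulr_natl.
Qed.
End Independence.

(** * Exponential moments and tail bounds *)

Section Chernoff.
Variable R : realType.

(** From [1 - x <= expR (- x)] follows [(1 - x) * expR x <= 1], while
    [(1 - x) * (1 + x + 2 * x ^+ 2)] equals [1 + x ^+ 2 * (1 - 2 * x)]. *)
Lemma expR_le_quadratic (x : R) : `|x| <= 2^-1 -> expR x <= 1 + x + 2 * x ^+ 2.
Proof.
move=> xh; have x1 : x <= 2^-1 by apply: le_trans xh; exact: ler_norm.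
have xN : - 2^-1 <= x by rewrite lerNl; apply: le_trans xh; rewrite -normrN ler_norm.
have H := expR_ge1Dx (- x); rewrite expRN in H.
have e0 := expR_gt0 x.
have H1 : (1 - x) * expR x <= 1.
  by rewrite -[X in _ <= X](mulVf (lt0r_neq0 e0)) ler_wpM2r // ltW.
suff : 0 <= (1 - x) * (1 + x + 2 * x ^+ 2 - expR x).
  by rewrite pmulr_rge0 ?subr_ge0 //; lra.
have -> : (1 - x) * (1 + x + 2 * x ^+ 2 - expR x)
   = (1 - (1 - x) * expR x) + x ^+ 2 * (1 - 2 * x) by ring.
by rewrite addr_ge0 ?subr_ge0 // mulr_ge0 ?sqr_ge0 //; lra.
Qed.

Variables (V : finType) (m : nat) (M : {set V}) (i : 'I_m).
Local Notation Omega := {ffun V -> 'I_m}.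

Definition hits (w : Omega) : nat := #|[set u in M | w u == i]|.

(** The sum factors over the vertices: one in [M] contributes [m - 1 + expR x], any other [m]. *)
Lemma mgf_hits (x : R) :
  \sum_(w : Omega) expR (x * (hits w)%:R) <=
  #|[set: Omega]|%:R * expR (#|M|%:R * ((expR x - 1) / m%:R)).
Proof.
have m0 : (0 < m)%N by apply: leq_ltn_trans (ltn_ord i).
have mR : 0 < m%:R :> R by rewrite ltr0n.
pose h (u : V) (j : 'I_m) : R := if (u \in M) && (j == i) then expR x else 1.
have -> : \sum_(w : Omega) expR (x * (hits w)%:R) = \prod_u \sum_j h u j.
  rewrite bigA_distr_bigA; apply: eq_bigr => w _.
  rewrite /hits -sum1_card natr_sum mulr_sumr expR_sum big_mkcond /=.
  by apply: eq_bigr => u _; rewrite /h inE; case: ifP => // _; rewrite mulr1.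
have hu u : \sum_j h u j <= m%:R * (if u \in M then expR ((expR x - 1) / m%:R) else 1).
  rewrite /h; case: ifP => uM /=; last first.
    by rewrite sumr_const card_ord mulr1.
  rewrite (bigD1 i) //= eqxx (eq_bigr (fun=> 1)) => [|j /negPf->//].
  rewrite sumr_const (eq_card (B := predC1 i)) // cardC1 card_ord.
  apply: le_trans (_ : m%:R * (1 + (expR x - 1) / m%:R) <= _); last first.
    by rewrite ler_pM2l // expR_ge1Dx.
  rewrite mulrDr mulr1 mulrCA divff ?mulr1 ?gt_eqF //.
  by rewrite -{2}(prednK m0) -natr1; lra.
have : \prod_u \sum_j h u j <=
    \prod_u (m%:R * (if u \in M then expR ((expR x - 1) / m%:R) else 1)).
  apply: ler_prod => u _; rewrite hu andbT sumr_ge0 // => j _; rewrite /h.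
  by case: ifP => _; rewrite ?expR_ge0 ?ler01.
move/le_trans; apply.
rewrite big_split /= prodr_const cardsT card_ffun card_ord natrX.
rewrite ler_pM2l ?exprn_gt0 // -big_mkcond prodr_const -expRM_natl.
by rewrite mulr_natl.
Qed.

(** Markov's inequality for the exponential moment, conditioned on [C], which ignores the
    coordinates in [M] and is thus independent of [hits]. Positive [x] serves the upper tail,
    negative [x] the lower one. *)
Lemma chernoff_hits (C : {set Omega}) (B : {set Omega}) (x b : R) :
    (forall v w : Omega, (forall u, u \notin M -> v u = w u) -> (v \in C) = (w \in C)) ->
    `|x| <= 2^-1 -> (forall w, w \in B -> b <= x * (hits w)%:R) ->
  #|B :&: C|%:R <= #|C|%:R * expR (#|M|%:R * ((x + 2 * x ^+ 2) / m%:R) - b).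
Proof.
move=> HC xh HB.
have m0 : (0 < m)%N by apply: leq_ltn_trans (ltn_ord i).
have O0 : 0 < #|[set: Omega]|%:R :> R.
  by rewrite ltr0n cardsT card_ffun card_ord expn_gt0 m0.
have H1 : #|B :&: C|%:R <= expR (- b) * \sum_(w in C) expR (x * (hits w)%:R).
  rewrite mulr_sumr -sum1_card natr_sum big_mkcond [X in _ <= X]big_mkcond /=.
  apply: ler_sum => w _; rewrite inE; case: (boolP (w \in B)) => /= [wB|_]; last first.
    by case: ifP => // _; rewrite mulr_ge0 // ltW // expR_gt0.
  case: ifP => // _; rewrite -expRD -[X in X <= _]expR0 ler_expR.
  by have := HB _ wB; lra.
apply: le_trans H1 _; rewrite -(ler_pM2l O0) mulrCA.
rewrite (@sum_independent R _ _ M) //; last first.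
  move=> a a' aa; congr (expR (_ * _%:R)); rewrite /hits.
  by congr #|pred_of_set _|; apply/setP => u; rewrite !inE; case: (boolP (u \in M)) => //= /aa->.
rewrite mulrCA [X in _ <= X]mulrCA ler_wpM2l //.
apply: le_trans (_ : expR (- b) * (#|[set: Omega]|%:R * expR (#|M|%:R * ((expR x - 1) / m%:R))) <= _).
  by rewrite ler_wpM2l ?mgf_hits // ltW // expR_gt0.
rewrite mulrCA ler_wpM2l // [X in _ <= expR X]addrC expRD ler_pM2l ?expR_gt0 //.
rewrite ler_expR ler_wpM2l // ler_wpM2r ?invr_ge0 //.
by have := expR_le_quadratic xh; lra.
Qed.

End Chernoff.

Local Open Scope nat_scope.

Lemma expR_Nnat_le (R : realType) (x : R) (N : nat) :
  (x <= - N%:R)%R -> (expR x * 2 ^+ N <= 1)%R.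
Proof.
move=> xN; have eN : (2 ^+ N <= expR N%:R :> R)%R.
  rewrite -[N%:R%R]mulr1 expRM_natl lerXn2r ?nnegrE ?expR_ge0 //.
  by apply: le_trans (expR_ge1Dx 1); lra.
apply: le_trans (_ : (expR (- N%:R) * expR N%:R <= 1)%R); last first.
  by rewrite -expRD addNr expR0.
by rewrite ler_pM ?expR_ge0 ?exprn_ge0 // ler_expR.
Qed.

Section Splitting.
Variables (R : realType) (G : sgraph) (m q N : nat).
Hypotheses (m0 : 0 < m) (q0 : 0 < q).
Hypothesis degN : 8 * q ^ 2 * m * N <= min_degree G.
Local Notation Omega := {ffun G -> 'I_m}.

Let above v i : {set Omega} :=
  [set w | q.+1 * #|nbh v| < q * m * hits (nbh v) i w].
Let below v i : {set Omega} :=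
  [set w | q * m * hits (nbh v) i w < q.-1 * #|nbh v|].
Let unbalanced v : {set Omega} := \bigcup_i (above v i :|: below v i).

Lemma card_above (v : G) i (C : {set Omega}) :
    (forall a b : Omega, (forall u, u \notin nbh v -> a u = b u) ->
      (a \in C) = (b \in C)) ->
  #|above v i :&: C| * 2 ^ N <= #|C| /\ #|below v i :&: C| * 2 ^ N <= #|C|.
Proof.
move=> HC; set d := #|nbh v|.
have dN : 8 * q ^ 2 * m * N <= d by exact: leq_trans degN (min_degree_le v).
have mR : (0 < m%:R :> R)%R by rewrite ltr0n.
have qR : (1 <= q%:R :> R)%R by rewrite ler1n.
have dNR : (8 * q%:R ^+ 2 * m%:R * N%:R <= d%:R :> R)%R by rewrite -natrX -!natrM ler_nat.
(* The relative deviation [1 / q] is [4 * e]. With [x] equal to [e] or [- e] it gains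
   [4 * e ^+ 2 * dm] against the quadratic error [2 * e ^+ 2 * dm]; the net exponent
   [- dm / (8 * q ^ 2)] is at most [- N] by [degN]. *)
pose e : R := ((4 * q%:R)^-1)%R.
have e0 : (0 < e)%R by rewrite invr_gt0; lra.
have eq1 : (e * q%:R = 4^-1)%R by rewrite /e; field; lra.
have eh : (e <= 2^-1)%R by nra.
pose dm : R := (d%:R / m%:R)%R.
have dmE : (dm * m%:R = d%:R)%R by rewrite /dm divfK // gt_eqF.
have key : (dm * (- 2 * e ^+ 2) <= - N%:R)%R.
  have dmN : (8 * q%:R ^+ 2 * N%:R <= dm)%R by rewrite ler_pdivlMr //; lra.
  have : (0 <= 2 * e ^+ 2 * (dm - 8 * q%:R ^+ 2 * N%:R))%R.
    by rewrite mulr_ge0 ?subr_ge0 // mulr_ge0 // sqr_ge0.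
  have -> : (2 * e ^+ 2 * (dm - 8 * q%:R ^+ 2 * N%:R) =
             2 * e ^+ 2 * dm - 16 * (e * q%:R) ^+ 2 * N%:R)%R by ring.
  by rewrite eq1; lra.
have fin (B : {set Omega}) x b :
    `|x|%R = e -> (forall w, w \in B -> b <= x * (hits (nbh v) i w)%:R)%R ->
    (d%:R * ((x + 2 * x ^+ 2) / m%:R) - b <= - N%:R)%R ->
    #|B :&: C| * 2 ^ N <= #|C|.
  move=> xe HB xN; have xh : (`|x| <= 2^-1)%R by rewrite xe.
  rewrite -(ler_nat R) natrM natrX.
  apply: le_trans (_ : #|C|%:R * (expR (d%:R * ((x + 2 * x ^+ 2) / m%:R) - b) * 2 ^+ N) <= _)%R.
    by rewrite mulrA ler_wpM2r ?exprn_ge0 // (chernoff_hits HC xh HB).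
  by rewrite -[X in (_ <= X)%R]mulr1 ler_wpM2l // expR_Nnat_le.
have rescale x : (d%:R * ((x + 2 * x ^+ 2) / m%:R) = dm * (x + 2 * x ^+ 2))%R.
  by rewrite /dm; ring.
have qK (y : R) : (4 * e ^+ 2 * (q%:R * y) = e * y)%R.
  by transitivity (4 * (e * q%:R) * (e * y))%R; [ring | rewrite eq1; lra].
have scale (a b y : nat) : a * d <= b * m * y -> (a%:R * dm <= b%:R * y%:R)%R.
  move=> H; rewrite -(ler_pM2r mR) -mulrA dmE -!natrM ler_nat.
  by rewrite mulnAC.
split.
- apply: (fin _ e (dm * (e + 4 * e ^+ 2))%R); first by rewrite gtr0_norm.
    move=> w; rewrite inE => /ltnW/scale H; rewrite -natr1 in H.
    have := qK dm; have := qK (hits (nbh v) i w)%:R%R.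
    have : (0 <= 4 * e ^+ 2)%R by rewrite mulr_ge0 // sqr_ge0.
    move=> e2; have := ler_wpM2l e2 H; lra.
  by rewrite rescale; apply: le_trans key; lra.
- apply: (fin _ (- e)%R (dm * (- e + 4 * e ^+ 2))%R); first by rewrite normrN gtr0_norm.
    move=> w; rewrite inE => /ltnW H.
    have {}H : (q%:R * (hits (nbh v) i w)%:R <= (q%:R - 1) * dm)%R.
      rewrite -(ler_pM2r mR) -[X in (_ <= X)%R]mulrA dmE -{2}(prednK q0) -natr1 addrK.
      by rewrite -!natrM ler_nat mulnAC.
    have := qK dm; have := qK (hits (nbh v) i w)%:R%R.
    have : (0 <= 4 * e ^+ 2)%R by rewrite mulr_ge0 // sqr_ge0.
    move=> e2; have := ler_wpM2l e2 H; lra.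
  by rewrite rescale; apply: le_trans key; lra.
Qed.

(** Local lemma with one event per vertex, determined by the classes of its neighbours. Events with
    disjoint neighbourhoods are independent, and the union over [m] classes and two tails bounds
    each probability by [2 * m / 2 ^ N]. *)
Lemma splitting : 8 * m * (max_degree G ^ 2).+1 <= 2 ^ N ->
  exists f : G -> nat, (forall v, f v < m) /\ balanced m q f.
Proof.
move=> HN; set Q := max_degree G ^ 2 in HN.
pose nb v : {set G} := [set u | nbh u :&: nbh v != finset.set0].
have nbQ v : #|nb v| <= Q.
  apply: leq_trans (_ : #|\bigcup_(z in nbh v) nbh z :&: finset.setT| <= _).
    apply: subset_leq_card; apply/fintype.subsetP => u; rewrite !inE andbT.
    case/finset.set0Pn => z; rewrite !inE => /andP[uz vz].
    by apply/bigcupP; exists z; rewrite !inE // adj_sym.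
  apply: leq_trans (card_bigcup_le _ _ _) _.
  apply: leq_trans (leq_sum _ (fun z _ => subset_leq_card (subsetIl _ _))) _.
  apply: leq_trans (leq_sum _ (fun z _ => card_nbh_max z)) _.
  by rewrite sum_nat_const /Q expnS expn1 leq_mul2r card_nbh_max orbT.
have hits_local v i (a b : Omega) :
    (forall u, u \in nbh v -> a u = b u) -> hits (nbh v) i a = hits (nbh v) i b.
  move=> ab; congr #|pred_of_set _|; apply/setP => u; rewrite !inE.
  by case: (boolP (adj v u)) => //= vu; rewrite ab ?inE.
have [|||v S dS||w Hw] := @local_lemma G Omega unbalanced nb (4 * Q.+1) Q.
- lia.
- lia.
- exact: nbQ.
- set C := avoid _ _.
  have HC (a b : Omega) : (forall u, u \notin nbh v -> a u = b u) ->
      (a \in C) = (b \in C).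
    move=> ab; rewrite !inE; apply: eq_forallb => u; case: (boolP (u \in S)) => //= uS.
    have uv : [disjoint nbh u & nbh v].
      have := disjointFr dS uS; rewrite inE => /negbFE/eqP uv.
      by rewrite -setI_eq0 uv.
    have ab' z : z \in nbh u -> a z = b z by move=> zu; apply: ab; rewrite (disjointFr uv zu).
    congr (~~ _); apply/bigcupP/bigcupP => -[i _ Hi]; exists i => //; move: Hi;
      by rewrite !inE (hits_local u i a b ab').
  have H1 : #|unbalanced v :&: C| * 2 ^ N <= 2 * m * #|C|.
    apply: leq_trans (_ : (\sum_(i < m) #|(above v i :|: below v i) :&: C|) * 2 ^ N <= _).
      by rewrite leq_mul2r card_bigcup_le orbT.
    rewrite big_distrl /=; apply: leq_trans (_ : \sum_(i < m) 2 * #|C| <= _).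
      apply: leq_sum => i _; have [Ha Hb] := card_above i HC.
      rewrite finset.setIUl; apply: leq_trans (_ : (#|above v i :&: C| + #|below v i :&: C|) * 2 ^ N <= _).
        by rewrite leq_mul2r leq_card_setU orbT.
      by rewrite mulnDl; lia.
    by rewrite sum_nat_const card_ord mulnA [m * 2]mulnC.
  have p2 := expn_gt0 2 N.
  rewrite -(leq_pmul2r p2); nia.
- by rewrite card_ffun card_ord expn_gt0 m0.
exists (fun v => w v : nat); split=> // v i im.
have := Hw v; rewrite /unbalanced => /bigcupP H.
have -> : #|[set u in nbh v | (w u : nat) == i]| = hits (nbh v) (Ordinal im) w by [].
rewrite leqNgt [_ <= q.+1 * _]leqNgt -negb_or; apply/negP => Hi; apply: H.
by exists (Ordinal im); rewrite // !inE orbC.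
Qed.

End Splitting.

Lemma strength_large (R : realType) (G : sgraph) (s l : nat) :
    0 < s -> 4096 * (2 * s + 1) <= l ->
    2 ^ l <= max_degree G < 2 ^ l.+1 -> l ^ 8 <= 256 * min_degree G ->
  exists2 k, irregularity_strength s.+1 G = Some k &
    k <= 4 * max_degree G ^ s + 3 * (max_degree G ^ s %/ l) + 4.
Proof.
move=> s0 ll logD dl; have l4 := l_ge s0 ll logD dl.
have m0 : 0 < l ^ 3 by rewrite expn_gt0; lia.
have q0 : 1 < 32 * l by lia.
have dP := degree_params s0 ll logD dl.
have [f [fm fbal]] := splitting R m0 (ltnW q0) dP (splitting_params s0 ll logD dl).
have [||c vc] := balanced_colouring fm fbal q0 _ _ (J_bounds s (max_degree G) l)
  (cover_params s0 ll logD dl) (room_params s0 ll logD dl).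
- by apply: leq_trans dP; rewrite !(muln_gt0, expn_gt0); lia.
- have H := J_small s0 ll logD dl.
  apply: leq_trans (_ : l ^ 2 <= _); first lia.
  by rewrite leq_exp2l; lia.
have [k kE kle] := valid_strength vc.
by exists k => //; apply: leq_trans kle _; lia.
Qed.

(** * Passage to natural logarithms and the asymptotic form *)

Local Open Scope classical_set_scope.
Local Open Scope ring_scope.

Lemma ln2_bounds (R : realType) : 2^-1 <= ln (2 : R) <= 1.
Proof.
have e1 : (2 : R) <= expR 1 by apply: le_trans (expR_ge1Dx 1); lra.
have e2 : expR 2^-1 <= 2 :> R.
  have := expR_ge1Dx (- 2^-1 : R); rewrite expRN => H.
  by rewrite -[leRHS]invrK -[leLHS]invrK lef_pV2 ?posrE ?invr_gt0 ?expR_gt0 //; lra.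
apply/andP; split; first by rewrite -[leLHS]expRK ler_ln ?posrE ?expR_gt0.
by rewrite -[leRHS]expRK ler_ln ?posrE ?expR_gt0.
Qed.

Lemma ln_log2_bounds (R : realType) (n l : nat) : (2 ^ l <= n < 2 ^ l.+1)%N ->
  l%:R / 2 <= ln (n%:R : R) <= l%:R + 1.
Proof.
have /andP[ln_ge ln_le] := ln2_bounds R; case/andP => ge_n lt_n.
have n0 : 0 < n%:R :> R by rewrite ltr0n (leq_trans _ ge_n) // expn_gt0.
have H k : ln (2 ^ k)%:R = ln 2 * k%:R :> R by rewrite natrX lnXn // mulr_natr.
apply/andP; split.
  apply: le_trans (_ : ln (2 ^ l)%:R <= _).
    by rewrite H mulrC ler_wpM2r.
  by rewrite ler_ln ?posrE ?ler_nat // ltr0n expn_gt0.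
apply: le_trans (_ : ln (2 ^ l.+1)%:R <= _).
  by rewrite ler_ln ?posrE // ?ltr0n ?expn_gt0 // ler_nat ltnW.
by rewrite H natr1 ler_piMl.
Qed.

Lemma strength_large_min_degree (R : realType) (s : nat) (G : sgraph) : (0 < s)%N ->
    (2 ^ (4096 * (2 * s + 1)) <= max_degree G)%N ->
    ln (max_degree G)%:R ^+ 8 <= (min_degree G)%:R :> R ->
  exists2 k : nat, irregularity_strength s.+1 G = Some k &
    k%:R < 4 * (max_degree G)%:R ^+ s * (1 + 1 / ln (max_degree G)%:R) + 12 :> R.
Proof.
move=> s0 D0 Hd; set Delta := max_degree G in D0 Hd *; set l0 := (4096 * _)%N in D0.
have Dpos : (0 < Delta)%N by apply: leq_trans D0; rewrite expn_gt0.
pose l := trunc_log 2 Delta.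
have ll : (2 ^ l <= Delta < 2 ^ l.+1)%N by exact: trunc_log_bounds.
have l0l : (l0 <= l)%N by rewrite -(trunc_expnK l0 (isT : 1 < 2)%N) leq_trunc_log.
have /andP[t1 t2] := ln_log2_bounds R ll; set t := ln _ in t1 t2 Hd *.
have l3 : (3 <= l)%N by apply: leq_trans l0l; rewrite /l0; lia.
have l3R : 3 <= l%:R :> R by rewrite (ler_nat R 3).
have [|k -> kle] := strength_large R s0 l0l ll.
  (* The factor 256 is [2 ^ 8], from [ln Delta >= l / 2]. *)
  rewrite -(ler_nat R) natrX natrM -ler_pdivrMl //.
  apply: le_trans Hd; apply: le_trans (_ : (l%:R / 2) ^+ 8 <= _).
    by rewrite expr_div_n; lra.
  by rewrite lerXn2r ?nnegrE //; lra.
exists k => //; rewrite -/Delta in kle.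
have {kle} : k%:R <= 4 * Delta%:R ^+ s + 3 * (Delta ^ s %/ l)%:R + 4 :> R.
  by rewrite -natrX -!natrM -!natrD ler_nat.
have D1 : 0 <= Delta%:R ^+ s :> R by rewrite exprn_ge0.
have : (Delta ^ s %/ l)%:R * l%:R <= Delta%:R ^+ s :> R.
  by rewrite -natrX -natrM ler_nat leq_divM.
set x := _%:R; set D := Delta%:R ^+ s in D1 *; move=> xl kle.
have t0 : 0 < t by lra.
(* Here [t <= l + 1] and [x * l <= D], so [3 * (l + 1) <= 4 * l] suffices; this is [l >= 3]. *)
suff : 3 * x <= 4 * (D / t) by rewrite mul1r mulrDr mulr1; lra.
rewrite mulrA ler_pdivlMr //; apply: le_trans (_ : 3 * x * (l%:R + 1) <= _).
  by rewrite ler_wpM2l // mulr_ge0.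
have x0 : 0 <= x by [].
have : x * 3 <= x * l%:R by rewrite ler_wpM2l.
lra.
Qed.

Lemma cvg_div_ln (R : realType) (a : R) : a / ln n%:R @[n --> \oo] --> (0 : R).
Proof.
apply/cvgrPdist_lt => e e0.
near=> n.
have nbig : expR (`|a| / e + 1) < n%:R by near: n; exact: nbhs_infty_gtr.
have n0 : 0 < n%:R :> R by apply: lt_trans nbig; exact: expR_gt0.
have lnn : `|a| / e + 1 < ln n%:R by rewrite -[X in X < _]expRK ltr_ln ?posrE ?expR_gt0.
have ae : 0 <= `|a| / e by rewrite divr_ge0 // ltW.
have l0 : 0 < ln n%:R :> R by lra.
rewrite sub0r normrN normrM normfV [`|ln _|]gtr0_norm // ltr_pdivrMr //.
by rewrite mulrC -ltr_pdivrMr //; lra.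
Unshelve. all: by end_near.
Qed.

Theorem theorem5 (R : realType) (r : nat) (hr : (2 <= r)%N) :
  (exists Delta0 : R, forall G : sgraph,
     Delta0 <= (max_degree G)%:R ->
     ln (max_degree G)%:R ^+ 8 <= (min_degree G)%:R :> R ->
     exists2 s : nat, irregularity_strength r G = Some s &
       s%:R < 4 * (max_degree G)%:R ^+ (r - 1)
                * (1 + 1 / ln (max_degree G)%:R) + 12 :> R)
  /\
  (exists2 o : nat -> R, o n @[n --> \oo] --> (0 : R) &
   forall G : sgraph,
     (1 <= max_degree G)%N ->
     ln (max_degree G)%:R ^+ 8 <= (min_degree G)%:R :> R ->
     no_isolated_edge G ->
     exists2 s : nat, irregularity_strength r G = Some s &
       s%:R <= (4 + o (max_degree G)) * (max_degree G)%:R ^+ (r - 1)).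
Proof.
case: r hr => // s; rewrite ltnS subn1 /= => s0.
set n0 := (2 ^ (4096 * (2 * s + 1)))%N; split.
  by exists n0%:R => G; rewrite ler_nat; exact: strength_large_min_degree.
(* The crude bound fills in finitely many values and does not affect the limit. In [16 / ln n], 4
   comes from the main term and 12 from the additive constant, because [ln Delta <= Delta ^ s]. *)
exists (fun n => if (n < n0)%N then (2 ^ (2 ^ (ball_bound s.+1 n).+1))%:R else 16 / ln n%:R).
  apply: cvg_trans (cvg_div_ln 16); apply: near_eq_cvg; near=> n.
  rewrite ltnNge; suff -> : (n0 <= n)%N by [].
  by near: n; exact: nbhs_infty_ge.
move=> G D1 Hd noK2; set Delta := max_degree G in D1 Hd *.
have D1R : 1 <= Delta%:R ^+ s :> R by rewrite -natrX ler1n expn_gt0 D1.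
case: ltnP => [small|large].
  have [k -> kle] := strength_crude (ltn0Sn s) noK2; exists k => //.
  apply: le_trans (_ : (2 ^ (2 ^ (ball_bound s.+1 Delta).+1))%:R <= _); first by rewrite ler_nat.
  set M := _%:R; have M0 : 0 <= M by []; nra.
have [k -> /ltW kle] := strength_large_min_degree s0 large Hd; exists k => //.
apply: le_trans kle _; rewrite -/Delta; set t := ln _.
have Dbig : (1 < Delta)%N.
  by apply: leq_trans large; rewrite -{1}(expn0 2) ltn_exp2l //; lia.
have t0 : 0 < t by rewrite ln_gt0 // ltr1n.
have tD : t <= Delta%:R ^+ s.
  apply: le_trans (_ : Delta%:R <= _).
    rewrite -[leRHS]expRK ler_ln ?posrE ?expR_gt0 ?ltr0n //.
    by apply: le_trans (expR_ge1Dx _); lra.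
  by rewrite -natrX ler_nat -[X in (X <= _)%N]expn1 leq_pexp2l.
have : 12 * 1 <= 12 * (Delta%:R ^+ s / t) by rewrite ler_wpM2l // ler_pdivlMr // mul1r.
lra.
Unshelve. all: by end_near.
Qed.
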